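(* Let $\{\mathcal G,(\Gamma_0,\Gamma_1),(\widetilde\Gamma_0,\widetilde\Gamma_1)\}$ be a triple for the adjoint pair $\{S,\widetilde S\}$ satisfying (G), (D), (M), with $\rho(A_0)\neq\emptyset$, $\gamma$-fields $\gamma,\widetilde\gamma$ and Weyl function $M$. Let $B_1,B_2$ be closable operators in $\mathcal G$ and suppose that for some $\lambda_0\in\rho(A_0)$ the operator $M(\lambda_0)B_1$ is closable and: (i) $1\in\rho(B_2\overline{M(\lambda_0)B_1})$; (ii) $\operatorname{ran}(B_2\overline{M(\lambda_0)B_1})\subset\operatorname{ran}\Gamma_0\cap\operatorname{dom}B_1$; (iii) $\operatorname{ran}(B_1\upharpoonright\operatorname{ran}\Gamma_0)\subset\operatorname{ran}\Gamma_0$; (iv) $\operatorname{ran}(B_2\upharpoonright\operatorname{ran}\Gamma_1)\subset\operatorname{ran}\Gamma_0$; (v) $\operatorname{ran}(\Gamma_1\upharpoonright\ker\Gamma_0)\subset\operatorname{dom}(B_1B_2)$. Then $A_{B_1B_2}$ is a closed operator with $\lambda_0\in\rho(A_{B_1B_2})$, and for all $\lambda\in\rho(A_0)\cap\rho(A_{B_1B_2})$ $(A_{B_1B_2}-\lambda)^{-1}=(A_0-\lambda)^{-1}+\gamma(\lambda)B_1(I-B_2M(\lambda)B_1)^{-1}B_2\widetilde\gamma(\overline\lambda)^*$.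
   Context: Let $\mathfrak H$ be a separable Hilbert space. An adjoint pair $\{S,\widetilde S\}$ consists of densely defined closed operators $S,\widetilde S$ in $\mathfrak H$ with $(Sf,g)=(f,\widetilde Sg)$ for all $f\in\operatorname{dom}S$, $g\in\operatorname{dom}\widetilde S$. Fix operators $T\subset S^*$ and $\widetilde T\subset\widetilde S^*$ which are cores, i.e. $\overline T=S^*$ and $\overline{\widetilde T}=\widetilde S^*$. A triple $\{\mathcal G,(\Gamma_0,\Gamma_1),(\widetilde\Gamma_0,\widetilde\Gamma_1)\}$ for $\{S,\widetilde S\}$ consists of a Hilbert space $\mathcal G$ and linear maps $\Gamma_0,\Gamma_1:\operatorname{dom}T\to\mathcal G$, $\widetilde\Gamma_0,\widetilde\Gamma_1:\operatorname{dom}\widetilde T\to\mathcal G$. Put $A_0:=T\upharpoonright\ker\Gamma_0$ and $\widetilde A_0:=\widetilde T\upharpoonright\ker\widetilde\Gamma_0$. Conditions: (G) $(Tf,g)_{\mathfrak H}-(f,\widetilde Tg)_{\mathfrak H}=(\Gamma_1f,\widetilde\Gamma_0g)_{\mathcal G}-(\Gamma_0f,\widetilde\Gamma_1g)_{\mathcal G}$ for all $f\in\operatorname{dom}T$, $g\in\operatorname{dom}\widetilde T$; (D) $\operatorname{ran}\Gamma_0$ and $\operatorname{ran}\widetilde\Gamma_0$ are dense in $\mathcal G$; (M) $A_0^*=\widetilde A_0$ and $\widetilde A_0^*=A_0$. For $\lambda\in\rho(A_0)$ one has $\operatorname{dom}T=\ker\Gamma_0\dotplus\ker(T-\lambda)$,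 so $\Gamma_0\upharpoonright\ker(T-\lambda)$ is injective; similarly for $\widetilde T$. The $\gamma$-fields are $\gamma(\lambda):=(\Gamma_0\upharpoonright\ker(T-\lambda))^{-1}$, $\widetilde\gamma(\mu):=(\widetilde\Gamma_0\upharpoonright\ker(\widetilde T-\mu))^{-1}$; the Weyl function is $M(\lambda):=\Gamma_1\gamma(\lambda)$, $\lambda\in\rho(A_0)$. Products of operators have their natural domains, e.g. $\operatorname{dom}(B_1B_2)=\{\varphi\in\operatorname{dom}B_2:B_2\varphi\in\operatorname{dom}B_1\}$; $(I-B_2M(\lambda)B_1)^{-1}$ is the inverse of the injective operator $I-B_2M(\lambda)B_1$. For a (not necessarily closed) operator $C$ in $\mathcal G$, $1\in\rho(C)$ means $I-C$ is a bijection of $\operatorname{dom}C$ onto $\mathcal G$ with bounded inverse; similarly $\rho(A)$ for operators in $\mathfrak H$. Define $A_{B_1B_2}f:=Tf$ on $\operatorname{dom}A_{B_1B_2}:=\{f\in\operatorname{dom}T:\Gamma_1f\in\operatorname{dom}(B_1B_2),\ B_1B_2\Gamma_1f=\Gamma_0f\}$. *)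

(* Defs.v *)
From HB Require Import structures.
From mathcomp Require Import all_boot all_order all_algebra.
From mathcomp Require Import complex.
From mathcomp Require Import boolp reals.
Set Implicit Arguments. Unset Strict Implicit. Unset Printing Implicit Defensive.
Import Order.TTheory GRing.Theory Num.Theory.
Local Open Scope ring_scope.

Section HilbertOps.
Variable C : numClosedFieldType.

Definition is_inner_product (V : lmodType C) (ip : V -> V -> C) : Prop :=
  [/\ forall (a : C) (x y z : V), ip (a *: x + y) z = a * ip x z + ip y z,
      forall x y : V, ip y x = (ip x y)^*,
      forall x : V, 0 <= ip x x &
      forall x : V, ip x x = 0 -> x = 0].

Definition nrm2 (V : lmodType C) (ip : V -> V -> C) (x : V) : C := ip x x.

Definition cvg_to (V : lmodType C) (ip : V -> V -> C) (u : nat -> V) (x : V) :=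
  forall e : C, 0 < e -> exists N, forall n, (N <= n)%N -> nrm2 ip (u n - x) < e.

Definition cauchy (V : lmodType C) (ip : V -> V -> C) (u : nat -> V) :=
  forall e : C, 0 < e -> exists N, forall n m, (N <= n)%N -> (N <= m)%N ->
    nrm2 ip (u n - u m) < e.

Definition dense (V : lmodType C) (ip : V -> V -> C) (D : V -> Prop) :=
  forall x : V, exists u : nat -> V, (forall n, D (u n)) /\ cvg_to ip u x.

Definition is_hilbert (V : lmodType C) (ip : V -> V -> C) : Prop :=
  is_inner_product ip /\ forall u, cauchy ip u -> exists x, cvg_to ip u x.

Definition separable (V : lmodType C) (ip : V -> V -> C) : Prop :=
  exists u : nat -> V, dense ip (fun x => exists n, u n = x).

(* ---------- (possibly unbounded) operators: partial maps ---------- *)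
Record op (U W : Type) := Op { dom : U -> Prop; ap : U -> W }.

Definition subspace (U : lmodType C) (D : U -> Prop) :=
  D 0 /\ forall (a : C) x y, D x -> D y -> D (a *: x + y).

Definition linear_on (U W : lmodType C) (D : U -> Prop) (f : U -> W) :=
  forall (a : C) x y, D x -> D y -> f (a *: x + y) = a *: f x + f y.

Definition linop (U W : lmodType C) (T : op U W) :=
  subspace (dom T) /\ linear_on (dom T) (ap T).

Definition op_eq (U W : Type) (T S : op U W) :=
  (forall x, dom T x <-> dom S x) /\ (forall x, dom T x -> ap T x = ap S x).

Definition op_sub (U W : Type) (T S : op U W) :=
  forall x, dom T x -> dom S x /\ ap S x = ap T x.

Definition ran (U W : Type) (T : op U W) (y : W) := exists x, dom T x /\ ap T x = y.

Definition restrict (U W : Type) (T : op U W) (P : U -> Prop) : op U W :=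
  Op (fun x => dom T x /\ P x) (ap T).

Definition op_comp (U V W : Type) (B : op V W) (A : op U V) : op U W :=
  Op (fun x => dom A x /\ dom B (ap A x)) (fun x => ap B (ap A x)).

Definition op_add (U W : lmodType C) (A B : op U W) : op U W :=
  Op (fun x => dom A x /\ dom B x) (fun x => ap A x + ap B x).

Definition lminus (U : lmodType C) (l : C) (T : op U U) : op U U :=
  Op (dom T) (fun x => l *: x - ap T x).

Definition minusl (U : lmodType C) (T : op U U) (l : C) : op U U :=
  Op (dom T) (fun x => ap T x - l *: x).

Definition pick (T : Type) (d : T) (P : T -> Prop) : T :=
  match pselect (exists x, P x) with
  | left h => projT1 (cid h)
  | right _ => d
  end.

(* inverse of an (injective) operator: defined on its range *)
Definition op_inv (U W : lmodType C) (T : op U W) : op W U :=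
  Op (ran T) (fun y => pick 0 (fun x => dom T x /\ ap T x = y)).

Definition in_graph_closure (U W : lmodType C) (ipU : U -> U -> C)
    (ipW : W -> W -> C) (T : op U W) (x : U) (y : W) :=
  exists u : nat -> U, (forall n, dom T (u n)) /\ cvg_to ipU u x /\
    cvg_to ipW (fun n => ap T (u n)) y.

Definition closed_op (U W : lmodType C) (ipU : U -> U -> C)
    (ipW : W -> W -> C) (T : op U W) :=
  forall x y, in_graph_closure ipU ipW T x y -> dom T x /\ ap T x = y.

Definition closable (U W : lmodType C) (ipU : U -> U -> C)
    (ipW : W -> W -> C) (T : op U W) :=
  forall y, in_graph_closure ipU ipW T 0 y -> y = 0.

(* the closure (meaningful for closable T) *)
Definition closure_op (U W : lmodType C) (ipU : U -> U -> C)
    (ipW : W -> W -> C) (T : op U W) : op U W :=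
  Op (fun x => exists y, in_graph_closure ipU ipW T x y)
     (fun x => pick 0 (in_graph_closure ipU ipW T x)).

(* the adjoint (meaningful for densely defined T) *)
Definition adj_rel (U W : lmodType C) (ipU : U -> U -> C)
    (ipW : W -> W -> C) (T : op U W) (y : W) (z : U) :=
  forall x, dom T x -> ipW (ap T x) y = ipU x z.

Definition adjoint (U W : lmodType C) (ipU : U -> U -> C)
    (ipW : W -> W -> C) (T : op U W) : op W U :=
  Op (fun y => exists z, adj_rel ipU ipW T y z)
     (fun y => pick 0 (adj_rel ipU ipW T y)).

Definition in_rho (U : lmodType C) (ip : U -> U -> C) (T : op U U) (l : C) :=
  (forall x y, dom T x -> dom T y -> l *: x - ap T x = l *: y - ap T y -> x = y) /\
  (forall y, exists x, dom T x /\ l *: x - ap T x = y) /\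
  exists c : C, forall x, dom T x -> nrm2 ip x <= c * nrm2 ip (l *: x - ap T x).

Definition A0_of (U W : lmodType C) (T : op U U) (G0 : U -> W) : op U U :=
  restrict T (fun f => G0 f = 0).

Definition bmap (U W : lmodType C) (T : op U U) (G : U -> W) : op U W :=
  Op (dom T) G.

Definition gamma_of (U W : lmodType C) (T : op U U) (G0 : U -> W) (l : C)
    : op W U :=
  op_inv (Op (fun f => dom T f /\ ap T f = l *: f) G0).

Definition weyl_of (U W : lmodType C) (T : op U U) (G0 G1 : U -> W) (l : C)
    : op W W :=
  op_comp (bmap T G1) (gamma_of T G0 l).

Definition A_B1B2 (U W : lmodType C) (T : op U U) (G0 G1 : U -> W)
    (B1 B2 : op W W) : op U U :=
  Op (fun f => dom T f /\ dom (op_comp B1 B2) (G1 f) /\ ap B1 (ap B2 (G1 f)) = G0 f)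
     (ap T).

End HilbertOps.

(* Main.v *)
(* For l in rho(A0), Green's identity gives gammat(conj l)^* = Gamma1 (A0 - l)^-1
   and shows that gamma(l) is closable; the density of dom gammat(conj l) rests on
   the surjectivity of A0^* - conj l, obtained from the Riesz representation theorem.
   Given h, put f0 = (A0 - l0)^-1 h and let phi solve
   (I - B2 cl(M(l0) B1)) phi = B2 Gamma1 f0; hypotheses (ii)-(v) make phi an element
   of dom(M(l0) B1) and f0 + gamma(l0) B1 phi a solution of (A_{B1B2} - l0) f = h.
   Each factor of this solution operator is an everywhere defined composition of a
   closable operator with a bounded one, hence bounded by the closed graph theorem.
   For a general l, phi = B2 Gamma1 f is read off from f = (A_{B1B2} - l)^-1 h. *)
Require Import Defs.
From HB Require Import structures.
From mathcomp Require Import all_boot all_order all_algebra.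
From mathcomp Require Import complex ring lra.
From mathcomp Require Import boolp classical_sets reals.
Set Implicit Arguments. Unset Strict Implicit. Unset Printing Implicit Defensive.
Import Order.TTheory GRing.Theory Num.Theory.
Local Open Scope complex_scope.
Local Open Scope ring_scope.

(** * Real-valued norms, the Cauchy-Schwarz inequality and convergence *)

Section InnerProduct.
Variables (R : realType) (V : lmodType R[i]) (ip : V -> V -> R[i]).
Hypothesis ipP : is_inner_product ip.

(** Valued in [R] and not in [R[i]], whose order is only partial: estimates then become linear
    arithmetic over an ordered field. *)
Definition ipnorm (x : V) : R := Num.sqrt (complex.Re (ip x x)).

Lemma ipDl x y z : ip (x + y) z = ip x z + ip y z.
Proof. by case: ipP => ipL _ _ _; rewrite -[x in LHS]scale1r ipL mul1r. Qed.

Lemma ip0l z : ip 0 z = 0.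
Proof. by apply: (addIr (ip 0 z)); rewrite -ipDl !add0r. Qed.

Lemma ipZl a x z : ip (a *: x) z = a * ip x z.
Proof. by case: ipP => ipL _ _ _; rewrite -[a *: x]addr0 ipL ip0l addr0. Qed.

Lemma ipNl x z : ip (- x) z = - ip x z.
Proof. by rewrite -scaleN1r ipZl mulN1r. Qed.

Lemma ipBl x y z : ip (x - y) z = ip x z - ip y z.
Proof. by rewrite ipDl ipNl. Qed.

Lemma ip_conj x y : ip y x = Num.conj (ip x y).
Proof. by case: ipP. Qed.

Lemma ipDr x y z : ip x (y + z) = ip x y + ip x z.
Proof. by rewrite ip_conj ipDl rmorphD /= -!ip_conj. Qed.

Lemma ipZr a x z : ip x (a *: z) = Num.conj a * ip x z.
Proof. by rewrite ip_conj ipZl rmorphM /= -!ip_conj. Qed.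

Lemma ipNr x z : ip x (- z) = - ip x z.
Proof. by rewrite ip_conj ipNl rmorphN /= -ip_conj. Qed.

Lemma ipBr x y z : ip x (y - z) = ip x y - ip x z.
Proof. by rewrite ipDr ipNr. Qed.

Lemma ip0r z : ip z 0 = 0.
Proof. by rewrite ip_conj ip0l rmorph0. Qed.

Lemma ip_ipnorm x : ip x x = (ipnorm x ^+ 2)%:C.
Proof.
case: ipP => _ _ /(_ x) ip_ge0 _.
have Re_ge0 : 0 <= complex.Re (ip x x) by move: ip_ge0; rewrite lecE => /andP[].
by rewrite sqr_sqrtr // RRe_real // ger0_real.
Qed.

Lemma ipnorm_ge0 x : 0 <= ipnorm x.
Proof. exact: sqrtr_ge0. Qed.

Lemma ipnorm0 : ipnorm 0 = 0.
Proof. by rewrite /ipnorm ip0l /= sqrtr0. Qed.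

Lemma ipnorm_eq0 x : ipnorm x = 0 -> x = 0.
Proof.
by case: ipP => _ _ _ ip_def nx0; apply: ip_def; rewrite ip_ipnorm nx0 expr0n.
Qed.

Lemma ipnorm_sqE x : ipnorm x ^+ 2 = complex.Re (ip x x).
Proof. by rewrite ip_ipnorm. Qed.

Lemma ipnormZ a x : ipnorm (a *: x) = complex.Re `|a| * ipnorm x.
Proof.
have na : `|a| = (complex.Re `|a|)%:C by rewrite RRe_real // ger0_real.
have na_ge0 : 0 <= complex.Re `|a| by rewrite -ler0c -na.
apply: (pexpIrn (n := 2)); rewrite ?nnegrE ?mulr_ge0 ?ipnorm_ge0 //.
apply: complexI; rewrite -ip_ipnorm ipZl ipZr mulrA -normCK {1}na ip_ipnorm.
by rewrite -rmorphXn -rmorphM exprMn.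
Qed.

Lemma ipnormN x : ipnorm (- x) = ipnorm x.
Proof. by rewrite -scaleN1r ipnormZ normrN normr1 /= mul1r. Qed.

Lemma ipdistC x y : ipnorm (x - y) = ipnorm (y - x).
Proof. by rewrite -ipnormN opprB. Qed.

Lemma ipnormZr (r : R) x : 0 <= r -> ipnorm (r%:C *: x) = r * ipnorm x.
Proof. by move=> r_ge0; rewrite ipnormZ ger0_norm ?ler0c. Qed.

(** Expand the squared norm of [|y|^2 x - (x, y) y], a multiple of the component of [x] orthogonal
    to [y]; it equals [|y|^2 (|x|^2 |y|^2 - |(x, y)|^2)]. *)
Lemma cauchy_schwarz x y : `|ip x y| <= (ipnorm x * ipnorm y)%:C.
Proof.
have [ny0|ny0] := eqVneq (ipnorm y) 0.
  by rewrite (ipnorm_eq0 ny0) ip0r normr0 ipnorm0 mulr0.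
have ny_gt0 : 0 < ipnorm y by rewrite lt_def ny0 ipnorm_ge0.
have: 0 <= ip ((ipnorm y ^+ 2)%:C *: x - ip x y *: y)
              ((ipnorm y ^+ 2)%:C *: x - ip x y *: y) by case: ipP.
rewrite ipBl !ipBr !ipZl !ipZr (ip_conj x y) !ip_ipnorm.
have -> : Num.conj (ipnorm y ^+ 2)%:C = (ipnorm y ^+ 2)%:C.
  by apply/CrealP/complex_realP; eexists.
set a := ip x y; set c := Num.conj a.
have ac : a * c = `|a| ^+ 2 by rewrite normCK.
have na : `|a| = (complex.Re `|a|)%:C by rewrite RRe_real // ger0_real.
have -> : (ipnorm y ^+ 2)%:C * ((ipnorm y ^+ 2)%:C * (ipnorm x ^+ 2)%:C) -
    (ipnorm y ^+ 2)%:C * (c * a) -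
    (a * ((ipnorm y ^+ 2)%:C * c) - a * (c * (ipnorm y ^+ 2)%:C)) =
  (ipnorm y ^+ 2)%:C * ((ipnorm y ^+ 2)%:C * (ipnorm x ^+ 2)%:C - a * c) by ring.
rewrite ac na -rmorphXn /= -rmorphM -rmorphB -rmorphM ler0c lecR.
have na_ge0 : 0 <= complex.Re `|a| by rewrite -ler0c -na.
rewrite pmulr_rge0 ?exprn_gt0 // subr_ge0 -exprMn mulrC.
by rewrite ler_pXn2r ?nnegrE ?mulr_ge0 ?ipnorm_ge0.
Qed.

Lemma Re_ip_le x y : complex.Re (ip x y) <= ipnorm x * ipnorm y.
Proof.
rewrite -lecR; apply: le_trans (cauchy_schwarz x y).
by apply: le_trans (normc_ge_Re _); rewrite lecR ler_norm.
Qed.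

Lemma ipnormD_sqE x y :
  ipnorm (x + y) ^+ 2 = ipnorm x ^+ 2 + 2 * complex.Re (ip x y) + ipnorm y ^+ 2.
Proof.
rewrite !ipnorm_sqE ipDl !ipDr (ip_conj x y) !raddfD /=.
have -> : complex.Re (Num.conj (ip x y)) = complex.Re (ip x y) by case: (ip x y).
ring.
Qed.

Lemma ipnormD x y : ipnorm (x + y) <= ipnorm x + ipnorm y.
Proof.
rewrite -(@ler_pXn2r _ 2) ?nnegrE ?addr_ge0 ?ipnorm_ge0 //.
by rewrite ipnormD_sqE; have := Re_ip_le x y; nra.
Qed.

Lemma ipnorm_dist_le z x y : ipnorm (x - y) <= ipnorm (x - z) + ipnorm (z - y).
Proof. by have := ipnormD (x - z) (z - y); rewrite addrA subrK. Qed.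

Lemma ipnorm_le_dist x y : ipnorm x <= ipnorm y + ipnorm (x - y).
Proof. by have := ipnormD y (x - y); rewrite subrKC. Qed.

(** [cvg_to] bounds squared norms by positive elements of [R[i]], which are real; the thresholds
    [e ^+ 2] and [sqrt (Re e)] translate between the two forms. *)
Lemma cvgP u x : cvg_to ip u x <->
  forall e : R, 0 < e -> exists K, forall n, (K <= n)%N -> ipnorm (u n - x) < e.
Proof.
split=> ux e e_gt0.
  have e2 : 0 < (e ^+ 2)%:C :> R[i] by rewrite ltcR exprn_gt0.
  have [K uK] := ux _ e2; exists K => n /uK.
  rewrite /nrm2 ip_ipnorm ltcR ltr_pXn2r // ?nnegrE ?ipnorm_ge0 //.
  exact: ltW.
have ee : e = (complex.Re e)%:C by rewrite RRe_real // gtr0_real.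
have Re_gt0 : 0 < complex.Re e by rewrite -ltcR -ee.
have [|K uK] := ux (Num.sqrt (complex.Re e)); first by rewrite sqrtr_gt0.
exists K => n /uK; rewrite /nrm2 ip_ipnorm ee ltcR => lt_n.
rewrite -(sqr_sqrtr (ltW Re_gt0)) ltr_pXn2r // ?nnegrE ?ipnorm_ge0 //.
exact: sqrtr_ge0.
Qed.

Lemma cauchyP u : cauchy ip u <->
  forall e : R, 0 < e -> exists K, forall n m, (K <= n)%N -> (K <= m)%N ->
    ipnorm (u n - u m) < e.
Proof.
split=> ux e e_gt0.
  have e2 : 0 < (e ^+ 2)%:C :> R[i] by rewrite ltcR exprn_gt0.
  have [K uK] := ux _ e2; exists K => n m Kn /(uK _ _ Kn).
  rewrite /nrm2 ip_ipnorm ltcR ltr_pXn2r // ?nnegrE ?ipnorm_ge0 //.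
  exact: ltW.
have ee : e = (complex.Re e)%:C by rewrite RRe_real // gtr0_real.
have Re_gt0 : 0 < complex.Re e by rewrite -ltcR -ee.
have [|K uK] := ux (Num.sqrt (complex.Re e)); first by rewrite sqrtr_gt0.
exists K => n m Kn /(uK _ _ Kn); rewrite /nrm2 ip_ipnorm ee ltcR => lt_n.
rewrite -(sqr_sqrtr (ltW Re_gt0)) ltr_pXn2r // ?nnegrE ?ipnorm_ge0 //.
exact: sqrtr_ge0.
Qed.

Lemma cvg_cst x : cvg_to ip (fun=> x) x.
Proof. by apply/cvgP => e e_gt0; exists 0%N => n _; rewrite subrr ipnorm0. Qed.

Lemma cvg_lincomb a u v x y : cvg_to ip u x -> cvg_to ip v y ->
  cvg_to ip (fun n => a *: u n + v n) (a *: x + y).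
Proof.
move=> /cvgP ux /cvgP vy; apply/cvgP => e e_gt0.
have na : 0 <= complex.Re `|a|.
  by have : 0 <= `|a| by []; rewrite lecE => /andP[].
have d_gt0 : 0 < (complex.Re `|a| + 1)^-1 * (e / 2).
  by rewrite mulr_gt0 ?invr_gt0 ?divr_gt0 //; lra.
have [K1 uK] := ux _ d_gt0.
have [|K2 vK] := vy (e / 2); first by lra.
exists (maxn K1 K2) => n; rewrite geq_max => /andP[/uK lt1 /vK lt2].
rewrite opprD addrACA -scalerBr; apply: le_lt_trans (ipnormD _ _) _.
rewrite ipnormZ.
have : complex.Re `|a| * ipnorm (u n - x) <= e / 2.
  apply: le_trans (ler_wpM2l na (ltW lt1)) _.
  rewrite mulrA ler_piMl //; first by lra.
  by rewrite ler_pdivrMr; lra.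
by move=> le1; lra.
Qed.

Lemma cvgB u v x y : cvg_to ip u x -> cvg_to ip v y ->
  cvg_to ip (fun n => u n - v n) (x - y).
Proof.
move=> ux vy; have := cvg_lincomb (-1) vy ux; rewrite scaleN1r addrC.
by congr cvg_to; apply/funext => n; rewrite scaleN1r addrC.
Qed.

Lemma cvg_ipnorm_le u x (c : R) : cvg_to ip u x ->
  (exists K, forall n, (K <= n)%N -> ipnorm (u n) <= c) -> ipnorm x <= c.
Proof.
move=> /cvgP ux [K1 uc]; rewrite leNgt; apply/negP => lt_c.
have [|K2 /(_ (maxn K1 K2)) uK] := ux (ipnorm x - c); first by lra.
have := uc (maxn K1 K2) (leq_maxl _ _); have := uK (leq_maxr _ _).
have := ipnorm_le_dist x (u (maxn K1 K2)); rewrite (ipdistC x) => *; lra.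
Qed.

Lemma cvg_unique u x y : cvg_to ip u x -> cvg_to ip u y -> x = y.
Proof.
move=> ux uy; apply/eqP; rewrite -subr_eq0; apply/eqP/ipnorm_eq0/le_anti.
rewrite ipnorm_ge0 andbT; apply: cvg_ipnorm_le (cvgB ux uy) _.
by exists 0%N => n _; rewrite subrr ipnorm0.
Qed.

End InnerProduct.

Section TwoSpaces.
Variables (R : realType) (U W : lmodType R[i]).
Variables (ipU : U -> U -> R[i]) (ipW : W -> W -> R[i]).
Hypotheses (ipUP : is_inner_product ipU) (ipWP : is_inner_product ipW).

(** Continuity of both inner products in the first argument, in the form in which Green's identity
    is carried to a limit. *)
Lemma cvg_ip_eq u v x y z w : cvg_to ipU u x -> cvg_to ipW v y ->
  (forall n, ipU (u n) z = ipW (v n) w) -> ipU x z = ipW y w.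
Proof.
move=> /(cvgP ipUP) ux /(cvgP ipWP) vy uv.
apply/eqP; rewrite -subr_eq0 -normr_eq0; apply/eqP.
set d := ipU x z - _.
have nd : `|d| = (complex.Re `|d|)%:C by rewrite RRe_real // ger0_real.
have nd_ge0 : 0 <= complex.Re `|d| by rewrite -ler0c -nd.
suff nd_le0 : complex.Re `|d| <= 0 by rewrite nd; congr _%:C; lra.
rewrite leNgt; apply/negP => nd_gt0.
(* The summand [1] keeps [s] positive and makes the last inequality strict: with [e = |d| / s],
   Cauchy-Schwarz gives [|d| <= e (|z| + |w|) < e s = |d|]. *)
set s := ipnorm ipU z + ipnorm ipW w + 1.
have nz := ipnorm_ge0 ipU z; have nw := ipnorm_ge0 ipW w.
have s_gt0 : 0 < s by rewrite /s; lra.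
have e_gt0 : 0 < complex.Re `|d| / s by rewrite divr_gt0.
have [K1 uK] := ux _ e_gt0; have [K2 vK] := vy _ e_gt0.
have := uK (maxn K1 K2) (leq_maxl _ _).
have := vK (maxn K1 K2) (leq_maxr _ _).
set n := maxn K1 K2; set e := _ / s => ltv ltu.
have dE : d = ipW (v n - y) w - ipU (u n - x) z.
  by rewrite /d (ipBl ipWP) (ipBl ipUP) uv; ring.
have : complex.Re `|d| <= ipnorm ipW (v n - y) * ipnorm ipW w +
                       ipnorm ipU (u n - x) * ipnorm ipU z.
  rewrite -lecR -nd dE; apply: le_trans (ler_normB _ _) _.
  by rewrite rmorphD lerD // cauchy_schwarz.
have es : complex.Re `|d| = e * s by rewrite /e divfK // gt_eqF.
have le1 := ler_wpM2r nw (ltW ltv); have le2 := ler_wpM2r nz (ltW ltu).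
have e_s : e * s = e * ipnorm ipU z + e * ipnorm ipW w + e by rewrite /s; ring.
have e0 : 0 < e by [].
by move=> le3; clear nd dE uv; clearbody e; lra.
Qed.

End TwoSpaces.

(** Approximating [z] itself from [D] gives [ip z z = 0]. *)
Lemma dense_orth (R : realType) (V : lmodType R[i]) (ip : V -> V -> R[i])
    (D : V -> Prop) (z : V) :
  is_inner_product ip -> dense ip D -> (forall x, D x -> ip x z = 0) -> z = 0.
Proof.
move=> ipP denseD Dz; have [u [Du uz]] := denseD z.
case: (ipP) => _ _ _; apply.
rewrite -(ip0l ipP z); apply: (cvg_ip_eq ipP ipP uz (cvg_cst ipP 0)) => n.
by rewrite Dz // ip0l.
Qed.

Lemma eventually_invS_lt (R : realType) (e : R) :
  0 < e -> exists K, forall n, (K <= n)%N -> n.+1%:R^-1 < e.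
Proof.
move=> /ltr_add_invr[K]; rewrite add0r => K_lt; exists K => n le_Kn.
apply: le_lt_trans K_lt.
by rewrite lef_pV2 ?posrE ?ltr0n // ler_nat ltnS.
Qed.

(** Reduces geometric decay to that of [1 / (n + 1)], which the Archimedean property controls. *)
Lemma half_expr_le_invS (R : realType) n : 2^-1 ^+ n <= n.+1%:R^-1 :> R.
Proof.
rewrite exprVn lef_pV2 ?posrE ?exprn_gt0 ?ltr0n // -natrX ler_nat.
exact: ltn_expl.
Qed.

(** * The Riesz representation theorem by minimisation *)

Section Riesz.
Variables (R : realType) (V : lmodType R[i]) (ip : V -> V -> R[i]).
Hypothesis hilbV : is_hilbert ip.
Variables (F : V -> R[i]) (K : R).
Hypothesis linF : forall a x y, F (a *: x + y) = a * F x + F y.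
Hypothesis boundF : forall x, `|F x| <= (K * ipnorm ip x)%:C.

Let ipP : is_inner_product ip := hilbV.1.
Let f x := complex.Re (F x).
(** If [F] is represented by [z], then [J x = |x - z|^2 - |z|^2]; so the representing vector is
    sought as the minimiser of [J]. *)
Let J x := ipnorm ip x ^+ 2 - 2 * f x.

Let F0 : F 0 = 0.
Proof.
have := linF 1 0 0; rewrite scale1r mul1r addr0 => F00.
by apply: (addIr (F 0)); rewrite -F00 add0r.
Qed.

Let fD x y : f (x + y) = f x + f y.
Proof. by rewrite /f -[x in LHS]scale1r linF mul1r raddfD. Qed.

Let fZ (t : R) x : f (t%:C *: x) = t * f x.
Proof.
rewrite /f -[_ *: x]addr0 linF F0 addr0.
by case: (F x) => a b /=; rewrite mul0r subr0.
Qed.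

Let f_le x : f x <= K * ipnorm ip x.
Proof.
rewrite -lecR; apply: le_trans (boundF x).
by apply: le_trans (normc_ge_Re _); rewrite lecR ler_norm.
Qed.

Let J_ge x : - K ^+ 2 <= J x.
Proof. by have := f_le x; have := sqr_ge0 (K - ipnorm ip x); rewrite /J sqrrB; lra. Qed.

Let Re_ipZr (t : R) x y : complex.Re (ip x (t%:C *: y)) = t * complex.Re (ip x y).
Proof.
rewrite ipZr //.
have -> : Num.conj t%:C = t%:C by apply/CrealP/complex_realP; eexists.
by case: (ip x y) => a b /=; rewrite mul0r subr0.
Qed.

Let JD x y : J (x + y) =
  J x + 2 * (complex.Re (ip x y) - f y) + ipnorm ip y ^+ 2.
Proof. by rewrite /J ipnormD_sqE // fD; ring. Qed.

(** The linear part of [J] cancels, which leaves the parallelogram law. Since [J] at the midpoint is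
    at least the infimum, two near-minimisers are close to each other. *)
Let parallelogram x y :
  ipnorm ip (x - y) ^+ 2 = 2 * J x + 2 * J y - 4 * J ((2^-1)%:C *: (x + y)).
Proof.
have half_ge0 : 0 <= 2^-1 :> R by rewrite invr_ge0.
rewrite /J fZ fD ipnormZr // exprMn !(ipnormD_sqE ipP) (ipnormN ipP).
have -> : complex.Re (ip x (- y)) = - complex.Re (ip x y).
  by rewrite ipNr // raddfN.
by field.
Qed.

(** A minimising sequence is Cauchy by [parallelogram]; varying its limit [z] along [x] identifies
    [Re F], and replacing [x] by [i x] recovers the imaginary part. *)
Lemma riesz : exists z, forall x, F x = ip x z.
Proof.
pose E : set R := fun r => exists x, J x = r.
have infE : has_inf E.
  split; first by exists (J 0), 0.
  by exists (- K ^+ 2) => _ [x <-].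
pose m := inf E.
have m_le x : m <= J x by apply: ge_inf; [exact: infE.2|exists x].
have [u uJ] : {u : nat -> V & forall n, J (u n) < m + n.+1%:R^-1}.
  apply: (@choice _ _ (fun n x => J x < m + n.+1%:R^-1)) => n.
  have n_gt0 : 0 < n.+1%:R^-1 :> R by rewrite invr_gt0 ltr0n.
  by have [_ [x <-] ltx] := inf_adherent n_gt0 infE; exists x.
have [z uz] : exists z, cvg_to ip u z.
  apply: hilbV.2; apply/cauchyP => // e e_gt0.
  have [|k kP] := @eventually_invS_lt R (e ^+ 2 / 4).
    by rewrite divr_gt0 ?exprn_gt0.
  exists k => n n' kn kn'.
  rewrite -(@ltr_pXn2r _ 2) ?nnegrE ?ipnorm_ge0 ?ltW // parallelogram.
  have := uJ n; have := uJ n'; have := kP _ kn; have := kP _ kn'.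
  have := m_le ((2^-1)%:C *: (u n + u n')).
  move: (J (u n)) (J (u n')) (J _) => a b c.
  move: (n.+1%:R^-1) (n'.+1%:R^-1) (e ^+ 2) => *; lra.
have Re_eq x : complex.Re (ip z x) = f x.
  have nx := ipnorm_ge0 ip x.
  (* This is [J z <= J (z + t x)] expanded. It is derived with [u n] in place of [z], up to an error
     [e]: one half pays for [J (u n) - m], the other for replacing [u n] by [z] in the linear
     term. *)
  have quad t : 0 <= 2 * t * (complex.Re (ip z x) - f x) + t ^+ 2 * ipnorm ip x ^+ 2.
    apply/ler_addgt0Pr => e e_gt0.
    have [|k1 k1P] := @eventually_invS_lt R (e / 2); first by lra.
    pose c := 2 * `|t| * ipnorm ip x + 1.
    have c_gt0 : 0 < c.
      by rewrite ltr_wpDl // !mulr_ge0 ?ipnorm_ge0.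
    have /(cvgP ipP) uz' := uz.
    have [|k2 k2P] := uz' (e / 2 / c); first by rewrite !divr_gt0.
    pose n := maxn k1 k2.
    have lt1 := k1P n (leq_maxl _ _); have lt2 := k2P n (leq_maxr _ _).
    have := m_le (u n + t%:C *: x); rewrite JD Re_ipZr fZ.
    have -> : ipnorm ip (t%:C *: x) ^+ 2 = t ^+ 2 * ipnorm ip x ^+ 2.
      rewrite ipnormZ // exprMn normc_def /= expr0n addr0 sqrtr_sqr.
      by rewrite real_normK ?num_real.
    have lt3 := uJ n.
    have le4 : 2 * (t * complex.Re (ip (u n - z) x)) <= e / 2.
      apply: le_trans (_ : 2 * `|t| * (ipnorm ip (u n - z) * ipnorm ip x) <= _).
        rewrite -mulrA; apply: ler_wpM2l => //.
        have := Re_ip_le ipP (u n - z) x; have := Re_ip_le ipP (- (u n - z)) x.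
        rewrite ipnormN // ipNl // raddfN /=.
        move=> leN leP; have [t0|t0] := ger0P t; first exact: ler_wpM2l.
        by rewrite -mulrNN; apply: ler_wpM2l => //; rewrite oppr_ge0 ltW.
      have : ipnorm ip (u n - z) * c <= e / 2 by rewrite -ler_pdivlMr // ltW.
      by have := ipnorm_ge0 ip (u n - z); rewrite /c; lra.
    move: le4; rewrite ipBl // raddfB /=.
    move: lt1 lt3; move: (J (u n)) (n.+1%:R^-1) => a b lt1 lt3 le4 le5.
    by lra.
  pose b := ipnorm ip x ^+ 2; have b_ge0 : 0 <= b by rewrite exprn_ge0 ?invr_ge0.
  (* Taking [t = - s] in [quad] gives [0 <= - s^2 (b + 2)], hence [s = 0]. The denominator [b + 1]
     is nonzero even for [x = 0]. *)
  pose s := (complex.Re (ip z x) - f x) / (b + 1).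
  have sE : complex.Re (ip z x) - f x = s * (b + 1) by rewrite /s divfK //; lra.
  have := quad (- s); rewrite sE -/b => q.
  have s0 : s ^+ 2 <= 0 by have := mulr_ge0 (sqr_ge0 s) b_ge0; have := sqr_ge0 s; lra.
  have /eqP : s ^+ 2 = 0 by apply/le_anti; rewrite s0 sqr_ge0.
  by rewrite expf_eq0 /= => /eqP s0'; move: sE; rewrite s0'; lra.
exists z => x.
have ReE y : complex.Re (F y) = complex.Re (ip y z).
  by rewrite -[LHS]Re_eq (ip_conj ipP y z); case: (ip y z).
(* [Re (i w) = - Im w], so equal real parts at [i x] mean equal imaginary parts at [x]. *)
have := ReE ('i%C *: x); rewrite -['i%C *: x]addr0 linF F0 addr0 addr0 ipZl //.
have := ReE x.
case: (F x) => a b; case: (ip x z) => c d /= -> ; rewrite !mul0r !mul1r !sub0r.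
by move=> /oppr_inj ->.
Qed.

End Riesz.

(** * The closed graph theorem by a Baire argument and successive approximation *)

Section ClosedGraph.
Variables (R : realType) (U W : lmodType R[i]).
Variables (ipU : U -> U -> R[i]) (ipW : W -> W -> R[i]).
Hypotheses (hilbU : is_hilbert ipU) (hilbW : is_hilbert ipW).
Variable L : U -> W.
Hypothesis linL : forall a x y, L (a *: x + y) = a *: L x + L y.

Let ipUP : is_inner_product ipU := hilbU.1.
Let ipWP : is_inner_product ipW := hilbW.1.

Let L0 : L 0 = 0.
Proof.
have := linL 1 0 0; rewrite !scale1r addr0 => L00.
by apply: (addIr (L 0)); rewrite -L00 add0r.
Qed.

Let LB x y : L (x - y) = L x - L y.
Proof. by rewrite addrC -scaleN1r linL scaleN1r addrC. Qed.

Let LZ a x : L (a *: x) = a *: L x.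
Proof. by rewrite -[a *: x]addr0 linL L0 addr0. Qed.

(* The Baire category argument: otherwise nested balls shrink to a point at
   which [ipnorm (L x)] exceeds every integer. *)
Lemma dense_sublevel : exists x0 (r : R) n, 0 < r /\
  forall z e, ipnorm ipU (z - x0) < r -> 0 < e ->
    exists x, ipnorm ipU (x - z) < e /\ ipnorm ipW (L x) <= n%:R.
Proof.
apply: contrapT => no_ball.
(* Here [p] holds the step number and the current ball, as centre and radius, and [q] is the next
   ball. The premise on the radius makes [good] satisfiable for every [p], as [choice] demands; for
   a radius that is not positive the dummy ball [(0, 0)] serves. *)
pose good (p : nat * (U * R)) (q : U * R) := 0 < p.2.2 ->
  [/\ 0 < q.2, q.2 <= p.1.+1%:R^-1 &
      forall x, ipnorm ipU (x - q.1) <= q.2 ->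
        ipnorm ipU (x - p.2.1) <= p.2.2 /\ p.1%:R < ipnorm ipW (L x)].
have [next nextP] : {g & forall p, good p (g p)}.
  apply: choice => -[n [x0 r]]; apply: contrapT => no_next.
  apply: no_ball; exists x0, r, n; split.
    by apply: contrapT => r_le0; apply: no_next; exists (0, 0) => /r_le0.
  move=> z e zr e_gt0; apply: contrapT => no_x; apply: no_next.
  (* The three bounds keep the new closed ball within distance [e] of [z], keep it inside the old
     ball, and force the radii to tend to [0]. *)
  pose r' := Num.min (e / 2) (Num.min (r - ipnorm ipU (z - x0)) n.+1%:R^-1).
  exists (z, r') => /= r_gt0; split.
  - by rewrite !lt_min invr_gt0 ltr0n subr_gt0 zr divr_gt0.
  - by rewrite !ge_min lexx !orbT.
  - move=> x /=; rewrite !le_min => /and3P[le1 le2 _]; split.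
      rewrite /=; have := ipnorm_dist_le ipUP z x x0; lra.
    rewrite ltNge; apply/negP => le_n; apply: no_x; exists x; split=> //.
    by lra.
pose s := fix s n := if n is n'.+1 then next (n', s n') else (0 : U, 1 : R).
have r_gt0 n : 0 < (s n).2.
  by elim: n => [|n IHn] //=; have [] := nextP (n, s n) IHn.
have sP n := nextP (n, s n) (r_gt0 n).
have nested n k x : ipnorm ipU (x - (s (n + k)%N).1) <= (s (n + k)%N).2 ->
    ipnorm ipU (x - (s n).1) <= (s n).2.
  elim: k => [|k IHk]; first by rewrite addn0.
  by rewrite addnS => le_x; apply: IHk; case: (sP (n + k)%N) => _ _ /(_ x le_x)[].
have in_ball n m : (n <= m)%N -> ipnorm ipU ((s m).1 - (s n).1) <= (s n).2.
  move=> le_nm; apply: (nested n (m - n)%N); rewrite subnKC //.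
  by rewrite subrr ipnorm0 // ltW.
have [x sx] : exists x, cvg_to ipU (fun n => (s n).1) x.
  apply: hilbU.2; apply/(cauchyP ipUP) => e e_gt0.
  have [|k /(_ k (leqnn k)) k_lt] := @eventually_invS_lt R (e / 2); first by lra.
  exists k.+1 => n m kn km.
  have r_le : (s k.+1).2 <= k.+1%:R^-1 by have [] := sP k.
  have := in_ball _ _ kn; have := in_ball _ _ km.
  have := ipnorm_dist_le ipUP (s k.+1).1 (s n).1 (s m).1.
  rewrite (ipdistC ipUP (s k.+1).1); move: (s k.+1) r_le k_lt => [y r] /=.
  by move: (k.+1%:R^-1) => d *; lra.
have x_in n : ipnorm ipU (x - (s n).1) <= (s n).2.
  apply: (cvg_ipnorm_le ipUP (cvgB ipUP sx (cvg_cst ipUP (s n).1))).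
  by exists n => m; exact: in_ball.
(* Ball [n + 1] carries the inequality [n < |L x|]; it fails when [n] is an Archimedean bound of
   [|L x|]. *)
have [_ _ /(_ x (x_in _.+1))[_]] := sP (Num.Def.archi_bound (ipnorm ipW (L x))).
by apply/negP; rewrite -leNgt ltW // archimedean.Num.Theory.archi_boundP // ipnorm_ge0.
Qed.

(** Scale [z] so that [t |z| = r / 2] and take sublevel points [a] near [x0 + t z] and [b] near
    [x0], each within [r / 8]. Then [a - b] misses [t z] by at most [r / 4], half of its norm, and
    [|L (a - b)| <= 2 n]; dividing by [t] gives the constant [4 n / r]. *)
Lemma approx_preimage : exists K, 0 <= K /\ forall z, exists x,
  ipnorm ipU (z - x) <= 2^-1 * ipnorm ipU z /\ ipnorm ipW (L x) <= K * ipnorm ipU z.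
Proof.
have [x0 [r [n [r_gt0 ballP]]]] := dense_sublevel.
exists (4 * n%:R / r); split; first by rewrite divr_ge0 ?mulr_ge0 ?ler0n // ltW.
move=> z; have [z0|nz0] := eqVneq (ipnorm ipU z) 0.
  by exists 0; rewrite subr0 L0 !ipnorm0 // z0 !mulr0.
have nz_gt0 : 0 < ipnorm ipU z by rewrite lt_def nz0 ipnorm_ge0.
pose t := r / 2 / ipnorm ipU z.
have t_gt0 : 0 < t by rewrite !divr_gt0.
have tz : t * ipnorm ipU z = r / 2 by rewrite divfK.
have e_gt0 : 0 < r / 8 by lra.
have [||a [a_near La]] := ballP (x0 + t%:C *: z) (r / 8) => //.
  by rewrite addrC addKr ipnormZr ?ltW // tz; lra.
have [||b [b_near Lb]] := ballP x0 (r / 8) => //; first by rewrite subrr ipnorm0.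
have tV : t * t^-1 = 1 by rewrite divff // gt_eqF.
have tV_ge0 : 0 <= t^-1 by rewrite invr_ge0 ltW.
have tVr : t^-1 * r = 2 * ipnorm ipU z.
  have -> : r = 2 * (t * ipnorm ipU z) by rewrite tz; field.
  have -> : t^-1 * (2 * (t * ipnorm ipU z)) = t * t^-1 * (2 * ipnorm ipU z) by ring.
  by rewrite tV mul1r.
exists (t^-1%:C *: (a - b)); split.
  have -> : z - t^-1%:C *: (a - b) =
      t^-1%:C *: ((b - x0) - (a - (x0 + t%:C *: z))).
    have -> w : (b - x0) - (a - (x0 + w)) = w - (a - b).
      by rewrite !opprB !addrA subrK [w + b]addrC.
    by rewrite [RHS]scalerBr scalerA -rmorphM /= mulrC tV scale1r.
  rewrite ipnormZr //; have := ipnormD ipUP (b - x0) (- (a - (x0 + t%:C *: z))).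
  rewrite ipnormN //; set h := ipnorm _ _ => le_h.
  have le_h' : h <= r / 4 by lra.
  by have := ler_wpM2l tV_ge0 le_h'; lra.
rewrite LZ LB ipnormZr //; have := ipnormD ipWP (L a) (- L b).
rewrite ipnormN //; set h := ipnorm _ _ => le_h.
have le_h' : h <= 2 * n%:R by lra.
apply: le_trans (ler_wpM2l tV_ge0 le_h') _.
have -> : t^-1 = 2 * ipnorm ipU z / r by rewrite -tVr mulfK // gt_eqF.
by rewrite le_eqVlt; apply/orP; left; apply/eqP; ring.
Qed.

(** Subtracting approximants repeatedly gives remainders [z n] that tend to [0] geometrically while
    [L (z n)] is Cauchy. The hypothesis makes the limit of [L (z n)] vanish, so [|L x|] is at most
    the sum of the series [K 2^-n |x|]. *)
Lemma closed_graph :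
  (forall u y, cvg_to ipU u 0 -> cvg_to ipW (L \o u) y -> y = 0) ->
  exists K, 0 <= K /\ forall x, ipnorm ipW (L x) <= K * ipnorm ipU x.
Proof.
move=> closL; have [K [K_ge0 approx]] := approx_preimage.
have [g gP] := choice approx.
exists (2 * K); split=> [|x]; first by lra.
have nx := ipnorm_ge0 ipU x.
pose z := fix z n := if n is n'.+1 then z n' - g (z n') else x.
have z_le n : ipnorm ipU (z n) <= 2^-1 ^+ n * ipnorm ipU x.
  elim: n => [|n IHn]; first by rewrite expr0 mul1r.
  have [le1 _] := gP (z n); rewrite exprS /=; lra.
(* The right side is the geometric sum of [K 2^-j |x|] over [n <= j < n + k]; this closed form makes
   the induction on [k] linear. *)
have Lz_le n k : ipnorm ipW (L (z (n + k)%N) - L (z n)) <=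
    2 * K * (2^-1 ^+ n - 2^-1 ^+ (n + k)) * ipnorm ipU x.
  elim: k => [|k IHk]; first by rewrite addn0 !subrr ipnorm0 // mulr0 mul0r.
  rewrite addnS /= LB; have [_ le_g] := gP (z (n + k)%N).
  have := ipnorm_dist_le ipWP (L (z (n + k)%N)) (L (z (n + k)%N) - L (g (z (n + k)%N)))
    (L (z n)).
  have -> : forall p q : W, p - q - p = - q by move=> p q; rewrite addrC addKr.
  rewrite ipnormN // exprS.
  by have := ler_wpM2l K_ge0 (z_le (n + k)%N); lra.
have z0 : cvg_to ipU z 0.
  apply/(cvgP ipUP) => e e_gt0.
  have [|k kP] := @eventually_invS_lt R (e / (ipnorm ipU x + 1)).
    by rewrite divr_gt0 //; lra.
  exists k => n /kP; rewrite ltr_pdivlMr; last by lra.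
  have := ler_wpM2r nx (half_expr_le_invS R n); have := z_le n; rewrite subr0.
  have : 0 < n.+1%:R^-1 :> R by rewrite invr_gt0 ltr0n.
  by move: (n.+1%:R^-1) (2^-1 ^+ n) => c d *; lra.
have Lz_near n m : (n <= m)%N ->
    ipnorm ipW (L (z m) - L (z n)) <= 2 * K * ipnorm ipU x * n.+1%:R^-1.
  move=> le_nm; have := Lz_le n (m - n)%N; rewrite subnKC // => le1.
  have c_ge0 : 0 <= 2 * K * ipnorm ipU x by rewrite !mulr_ge0.
  have := ler_wpM2l c_ge0 (half_expr_le_invS R n).
  have : 0 <= 2^-1 ^+ m :> R by rewrite exprn_ge0 ?invr_ge0.
  move=> /(mulr_ge0 c_ge0).
  by move: le1; move: (n.+1%:R^-1) (2^-1 ^+ n) (2^-1 ^+ m) => c d e *; lra.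
have [y Lzy] : exists y, cvg_to ipW (L \o z) y.
  apply: hilbW.2; apply/(cauchyP ipWP) => e e_gt0.
  pose c := 2 * K * ipnorm ipU x.
  have c_ge0 : 0 <= c by rewrite !mulr_ge0.
  have [|k /(_ k (leqnn k)) k_lt] := @eventually_invS_lt R (e / (2 * (c + 1))).
    by rewrite divr_gt0 //; lra.
  move: k_lt; rewrite ltr_pdivlMr; last by lra.
  have : 0 < k.+1%:R^-1 :> R by rewrite invr_gt0 ltr0n.
  move=> k_gt0 k_lt; exists k => n m kn km /=.
  have := Lz_near _ _ kn; have := Lz_near _ _ km; rewrite -/c.
  have := ipnorm_dist_le ipWP (L (z k)) (L (z n)) (L (z m)).
  rewrite (ipdistC ipWP (L (z k))).
  by move: k_gt0 k_lt; move: (k.+1%:R^-1) => d *; lra.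
have y0 := closL _ _ z0 Lzy; rewrite {}y0 in Lzy.
have := cvgB ipWP (cvg_cst ipWP (L x)) Lzy; rewrite subr0 => /(cvg_ipnorm_le ipWP).
apply; exists 0%N => n _ /=; rewrite (ipdistC ipWP).
have := Lz_le 0%N n; rewrite add0n /= expr0.
have : 0 <= 2^-1 ^+ n :> R by rewrite exprn_ge0 ?invr_ge0.
have c_ge0 : 0 <= 2 * K * ipnorm ipU x by rewrite !mulr_ge0.
by move=> /(mulr_ge0 c_ge0); lra.
Qed.

End ClosedGraph.

(** * Partially defined linear operators, their closures and adjoints *)

Section LinearOperators.
Variable R : realType.
Implicit Types U V W : lmodType R[i].

Lemma pick_spec (A : Type) (d : A) (P : A -> Prop) : (exists x, P x) -> P (Defs.pick d P).
Proof. by rewrite /Defs.pick => exP; case: pselect => // h; case: (cid h). Qed.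

Lemma op_inv_ap U W (T : op U W) x :
  (forall x y, dom T x -> dom T y -> ap T x = ap T y -> x = y) -> dom T x ->
  ap (op_inv T) (ap T x) = x.
Proof.
move=> injT Tx; have exx : exists x', dom T x' /\ ap T x' = ap T x by exists x.
by have [Tx' /injT] := pick_spec 0 exx; apply.
Qed.

Section OneOperator.
Variables (U W : lmodType R[i]) (T : op U W).
Hypothesis linT : linop T.

Lemma linop_dom0 : dom T 0.
Proof. by case: linT => -[]. Qed.

Lemma linop_domL a x y : dom T x -> dom T y -> dom T (a *: x + y).
Proof. by case: linT => -[_ domL] _; exact: domL. Qed.

Lemma linop_apL a x y : dom T x -> dom T y -> ap T (a *: x + y) = a *: ap T x + ap T y.
Proof. by case: linT => _ apL; exact: apL. Qed.

Lemma linop_domB x y : dom T x -> dom T y -> dom T (x - y).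
Proof. by move=> Tx Ty; rewrite addrC -scaleN1r; exact: linop_domL. Qed.

Lemma linop_apB x y : dom T x -> dom T y -> ap T (x - y) = ap T x - ap T y.
Proof. by move=> Tx Ty; rewrite addrC -scaleN1r linop_apL // scaleN1r addrC. Qed.

Lemma linop_domD x y : dom T x -> dom T y -> dom T (x + y).
Proof. by move=> Tx Ty; rewrite -[x]scale1r; exact: linop_domL. Qed.

Lemma linop_apD x y : dom T x -> dom T y -> ap T (x + y) = ap T x + ap T y.
Proof. by move=> Tx Ty; rewrite -[x in LHS]scale1r linop_apL // scale1r. Qed.

Lemma linop_ap0 : ap T 0 = 0.
Proof.
by rewrite -[X in ap T X](subrr 0) linop_apB ?subrr //; exact: linop_dom0.
Qed.

End OneOperator.

Lemma linop_comp U V W (B : op V W) (A : op U V) :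
  linop B -> linop A -> linop (op_comp B A).
Proof.
move=> linB linA; split; [split|].
- by split; [exact: linop_dom0|rewrite linop_ap0 //; exact: linop_dom0].
- move=> a x y [Ax Bx] [Ay By]; split; first exact: linop_domL.
  by rewrite linop_apL //; exact: linop_domL.
- by move=> a x y [Ax Bx] [Ay By] /=; rewrite !linop_apL.
Qed.

Lemma linop_lminus U (T : op U U) l : linop T -> linop (lminus l T).
Proof.
move=> linT; split; first exact: linT.1.
move=> a x y Tx Ty /=; rewrite linop_apL // scalerDr scalerBr !scalerA.
by rewrite opprD addrACA [l * a]mulrC.
Qed.

Section Closure.
Variables (U W : lmodType R[i]) (ipU : U -> U -> R[i]) (ipW : W -> W -> R[i]).
Hypotheses (ipUP : is_inner_product ipU) (ipWP : is_inner_product ipW).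
Variable T : op U W.
Hypotheses (linT : linop T) (closT : closable ipU ipW T).
Local Notation gclosure := (in_graph_closure ipU ipW T).

Lemma graph_closureL a x y x' y' : gclosure x y -> gclosure x' y' ->
  gclosure (a *: x + x') (a *: y + y').
Proof.
move=> [u [Tu [ux Tuy]]] [v [Tv [vx Tvy]]]; exists (fun n => a *: u n + v n).
split; first by move=> n; exact: linop_domL.
split; first exact: cvg_lincomb.
have -> : (fun n => ap T (a *: u n + v n)) = (fun n => a *: ap T (u n) + ap T (v n)).
  by apply/funext => n; rewrite linop_apL.
exact: cvg_lincomb.
Qed.

(** The graph closure is a subspace, so uniqueness at [0], which is closability, gives uniqueness
    everywhere and fixes the value that [pick] selects in [closure_op]. *)
Lemma graph_closure_uniq x y y' : gclosure x y -> gclosure x y' -> y = y'.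
Proof.
move=> xy xy'; apply/eqP; rewrite -subr_eq0; apply/eqP/closT.
by have := graph_closureL (-1) xy' xy; rewrite !scaleN1r addNr addrC.
Qed.

Lemma closure_opP x y : gclosure x y ->
  dom (closure_op ipU ipW T) x /\ ap (closure_op ipU ipW T) x = y.
Proof.
move=> xy; split; first by exists y.
apply: (graph_closure_uniq _ xy); exact: (pick_spec 0 (ex_intro _ y xy)).
Qed.

Lemma closure_op_ext x : dom T x ->
  dom (closure_op ipU ipW T) x /\ ap (closure_op ipU ipW T) x = ap T x.
Proof.
move=> Tx; apply: closure_opP; exists (fun=> x); split=> [_ //|]; split; exact: cvg_cst.
Qed.

Lemma linop_closure : linop (closure_op ipU ipW T).
Proof.
split; [split|].
- by have [] := closure_op_ext (linop_dom0 linT).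
- by move=> a x y [x' xx'] [y' yy']; exists (a *: x' + y'); exact: graph_closureL.
- move=> a x y [x' xx'] [y' yy'].
  have [_ ->] := closure_opP xx'; have [_ ->] := closure_opP yy'.
  by have [_ ->] := closure_opP (graph_closureL a xx' yy').
Qed.

End Closure.

(** Two candidates for the value differ by a vector orthogonal to the dense domain, so [pick] can
    only return [z]. *)
Lemma adjoint_ap U W (ipU : U -> U -> R[i]) (ipW : W -> W -> R[i]) (T : op U W) y z :
  is_inner_product ipU -> dense ipU (dom T) -> adj_rel ipU ipW T y z ->
  dom (adjoint ipU ipW T) y /\ ap (adjoint ipU ipW T) y = z.
Proof.
move=> ipUP denseT yz; split; first by exists z.
have yz' : adj_rel ipU ipW T y (ap (adjoint ipU ipW T) y)
  by exact: (pick_spec 0 (ex_intro _ z yz)).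
apply/eqP; rewrite -subr_eq0; apply/eqP.
apply: (dense_orth ipUP denseT) => x Tx.
by rewrite ipBr // -yz // -yz' // subrr.
Qed.

(** Stated for total functions and not for [op]: it serves composites that are defined everywhere
    although some factors are not. *)
Definition bounded_linear U W (ipU : U -> U -> R[i]) (ipW : W -> W -> R[i])
    (f : U -> W) :=
  (forall a x y, f (a *: x + y) = a *: f x + f y) /\
  exists K, 0 <= K /\ forall x, ipnorm ipW (f x) <= K * ipnorm ipU x.

Lemma bounded_linear_comp U V W (ipU : U -> U -> R[i]) (ipV : V -> V -> R[i])
    (ipW : W -> W -> R[i]) (g : V -> W) (f : U -> V) :
  bounded_linear ipV ipW g -> bounded_linear ipU ipV f ->
  bounded_linear ipU ipW (g \o f).
Proof.
move=> [ling [K [K_ge0 gK]]] [linf [K' [K'_ge0 fK]]]; split.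
  by move=> a x y /=; rewrite linf ling.
exists (K * K'); split=> [|x]; first exact: mulr_ge0.
by apply: le_trans (gK _) _; rewrite -mulrA ler_wpM2l.
Qed.

Lemma bounded_linearD U W (ipU : U -> U -> R[i]) (ipW : W -> W -> R[i]) (f g : U -> W) :
  is_inner_product ipW -> bounded_linear ipU ipW f -> bounded_linear ipU ipW g ->
  bounded_linear ipU ipW (f \+ g).
Proof.
move=> ipWP [linf [K [K_ge0 fK]]] [ling [K' [K'_ge0 gK]]]; split.
  by move=> a x y /=; rewrite linf ling scalerDr addrACA.
exists (K + K'); split=> [|x]; first exact: addr_ge0.
by apply: le_trans (ipnormD ipWP _ _) _; rewrite mulrDl lerD.
Qed.

Lemma bounded_linear_cvg0 U W (ipU : U -> U -> R[i]) (ipW : W -> W -> R[i])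
    (f : U -> W) u :
  is_inner_product ipU -> is_inner_product ipW -> bounded_linear ipU ipW f ->
  cvg_to ipU u 0 -> cvg_to ipW (f \o u) 0.
Proof.
move=> ipUP ipWP [_ [K [K_ge0 fK]]] /(cvgP ipUP) u0; apply/(cvgP ipWP) => e e_gt0.
have [|k kP] := u0 (e / (K + 1)); first by rewrite divr_gt0 //; lra.
exists k => n /kP; rewrite !subr0 /= ltr_pdivlMr; last by lra.
by have := fK (u n); have := ipnorm_ge0 ipU (u n); lra.
Qed.

(** If [u] tends to [0], so does [f \o u], and closability of [B] excludes a nonzero limit of
    [B (f (u n))]; the closed graph theorem then bounds the composite although [B] may be
    unbounded. *)
Lemma closable_comp_bounded U V W (ipU : U -> U -> R[i]) (ipV : V -> V -> R[i])
    (ipW : W -> W -> R[i]) (B : op V W) (f : U -> V) :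
  is_hilbert ipU -> is_inner_product ipV -> is_hilbert ipW ->
  linop B -> closable ipV ipW B -> bounded_linear ipU ipV f ->
  (forall x, dom B (f x)) -> bounded_linear ipU ipW (ap B \o f).
Proof.
move=> hilbU ipVP hilbW linB closB bf domBf.
have linBf a x y : (ap B \o f) (a *: x + y) = a *: (ap B \o f) x + (ap B \o f) y.
  by rewrite /= bf.1 linop_apL.
split=> //; apply: closed_graph => // u y u0 Bfu; apply: closB.
exists (f \o u); split; first by move=> n; exact: domBf.
by split=> //; apply: bounded_linear_cvg0 u0 => //; case: hilbU.
Qed.

(** * Resolvent points: bounded inverse and closedness *)

Section Resolvent.
Variables (U : lmodType R[i]) (ip : U -> U -> R[i]) (T : op U U) (l : R[i]).
Hypotheses (ipP : is_inner_product ip) (linT : linop T) (rhoT : in_rho ip T l).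

(** The constant in [in_rho] is an element of [R[i]] and compares squared norms; the square root of
    its modulus is the real constant sought. *)
Lemma in_rho_bound : exists K, 0 <= K /\
  forall x, dom T x -> ipnorm ip x <= K * ipnorm ip (l *: x - ap T x).
Proof.
have [_ [_ [c cP]]] := rhoT; pose d := complex.Re `|c|.
have cE : `|c| = d%:C by rewrite RRe_real // ger0_real.
have d_ge0 : 0 <= d by rewrite -ler0c -cE.
exists (Num.sqrt d); split=> [|x Tx]; first exact: sqrtr_ge0.
rewrite -(@ler_pXn2r _ 2) ?nnegrE ?mulr_ge0 ?sqrtr_ge0 ?ipnorm_ge0 //.
have x_ge0 : 0 <= ip x x by case: ipP.
have y_ge0 : 0 <= ip (l *: x - ap T x) (l *: x - ap T x) by case: ipP.
rewrite exprMn (sqr_sqrtr d_ge0) -lecR -ip_ipnorm //.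
have -> : (d * ipnorm ip (l *: x - ap T x) ^+ 2)%:C =
    `|c| * ip (l *: x - ap T x) (l *: x - ap T x).
  by rewrite cE ip_ipnorm // -rmorphM.
have le_c := cP x Tx.
rewrite -[X in _ * X](ger0_norm y_ge0) -normrM ger0_norm //.
exact: le_trans le_c.
Qed.

Lemma in_rho_inj0 x : dom T x -> ap T x = l *: x -> x = 0.
Proof.
move=> Tx Txl; apply: rhoT.1 => //; first exact: linop_dom0.
by rewrite Txl linop_ap0 // scaler0 !subrr.
Qed.

Lemma in_rho_resolvent : exists Q : U -> U, bounded_linear ip ip Q /\
  forall y, dom T (Q y) /\ l *: Q y - ap T (Q y) = y.
Proof.
have [Q QP] := choice rhoT.2.1; exists Q; split=> //.
split=> [a x y|].
  have [Qx eqx] := QP x; have [Qy eqy] := QP y; have [Qxy eqxy] := QP (a *: x + y).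
  apply: rhoT.1 => //; first exact: linop_domL.
  have := linop_apL (linop_lminus l linT) a Qx Qy => /= ->.
  by rewrite eqx eqy eqxy.
have [K [K_ge0 KP]] := in_rho_bound; exists K; split=> // y.
by have [Qy eqy] := QP y; have := KP _ Qy; rewrite eqy.
Qed.

(** Solve [(l - T) x' = l x - y]. The resolvent bound turns [(l - T) (u n - x') -> 0] into
    [u n -> x'], whence [x = x']. *)
Lemma in_rho_closed : closed_op ip ip T.
Proof.
move=> x y [u [Tu [ux Tuy]]].
have [x' [Tx' eqx']] := rhoT.2.1 (l *: x - y).
have [K [K_ge0 KP]] := in_rho_bound.
suff ux' : cvg_to ip u x'.
  have xx' := cvg_unique ipP ux ux'; move: eqx'; rewrite -xx' => eqx.
  by split; [rewrite xx'|apply: oppr_inj; apply: addrI eqx].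
have := cvgB ipP (cvg_lincomb ipP l ux (cvg_cst ipP 0)) Tuy.
rewrite addr0 -eqx' => /(cvgP ipP) luT.
apply/(cvgP ipP) => e e_gt0.
have [|k kP] := luT (e / (K + 1)); first by rewrite divr_gt0 //; lra.
exists k => n /kP; rewrite addr0 ltr_pdivlMr; last by lra.
have dux := linop_domB linT (Tu n) Tx'; have := KP _ dux.
have := linop_apB (linop_lminus l linT) (Tu n) Tx' => /= ->.
set q := _ - _ - _; have := ipnorm_ge0 ip q; lra.
Qed.

End Resolvent.

(** Injectivity turns the right inverse [Q] into a left inverse, so its bound becomes the estimate
    in [in_rho], squared. *)
Lemma in_rho_of_bounded U (ip : U -> U -> R[i]) (T : op U U) l (Q : U -> U) :
  is_inner_product ip -> linop T -> bounded_linear ip ip Q ->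
  (forall x, dom T x -> ap T x = l *: x -> x = 0) ->
  (forall y, dom T (Q y) /\ l *: Q y - ap T (Q y) = y) -> in_rho ip T l.
Proof.
move=> ipP linT [_ [K [K_ge0 QK]]] inj0 QP.
have inj x y : dom T x -> dom T y -> l *: x - ap T x = l *: y - ap T y -> x = y.
  move=> Tx Ty eqxy; apply/eqP; rewrite -subr_eq0; apply/eqP/inj0.
    exact: linop_domB.
  have := linop_apB (linop_lminus l linT) Tx Ty; rewrite /= eqxy subrr => /eqP.
  by rewrite subr_eq0 => /eqP ->.
split=> //; split; first by move=> y; exists (Q y); exact: QP.
exists (K ^+ 2)%:C => x Tx; have [TQ eqQ] := QP (l *: x - ap T x).
rewrite /nrm2 !ip_ipnorm // -rmorphM lecR -exprMn.
rewrite ler_pXn2r ?nnegrE ?mulr_ge0 ?ipnorm_ge0 //.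
by rewrite -{1}(inj _ _ TQ Tx eqQ).
Qed.

End LinearOperators.

(** * The gamma-field and the Weyl function at one point *)

Section GammaField.
Variables (R : realType) (H G : lmodType R[i]) (T : op H H) (G0 G1 : H -> G) (l : R[i]).
Hypotheses (linT : linop T) (linG0 : linear_on (dom T) G0).
(** With [surj0], the purely algebraic content of [l] being a resolvent point of [A_0]. In this form
    the section also applies to [Tt] at the conjugate point. *)
Hypothesis inj0 : forall f, dom T f -> G0 f = 0 -> ap T f = l *: f -> f = 0.
Hypothesis surj0 : forall h, exists f, [/\ dom T f, G0 f = 0 & l *: f - ap T f = h].
Local Notation gamma := (gamma_of T G0 l).

Let linB0 : linop (bmap T G0) := conj linT.1 linG0.

Lemma A0_linop : linop (A0_of T G0).
Proof.
split; [split|].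
- by split; [exact: linop_dom0|exact: (linop_ap0 linB0)].
- move=> a x y [Tx x0] [Ty y0]; split; first exact: linop_domL.
  by have /= -> := linop_apL linB0 a Tx Ty; rewrite x0 y0 scaler0 addr0.
- by move=> a x y [Tx _] [Ty _]; exact: (linop_apL linT).
Qed.

Lemma gamma_ap f : dom T f -> ap T f = l *: f ->
  dom gamma (G0 f) /\ ap gamma (G0 f) = f.
Proof.
move=> Tf eqf; split; first by exists f.
apply: (@op_inv_ap _ _ _ (Op (fun f => dom T f /\ ap T f = l *: f) G0)) => // x y.
move=> [Tx eqx] [Ty eqy] /= eqxy; apply/eqP; rewrite -subr_eq0; apply/eqP/inj0.
- exact: linop_domB.
- by have /= -> := linop_apB linB0 Tx Ty; rewrite eqxy subrr.
- by rewrite linop_apB // eqx eqy scalerBr.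
Qed.

Lemma gamma_dom y : dom gamma y ->
  exists f, [/\ dom T f, ap T f = l *: f, G0 f = y & ap gamma y = f].
Proof.
by move=> [f [[Tf eqf] /= <-]]; exists f; split=> //; have [] := gamma_ap Tf eqf.
Qed.

(** This is the decomposition of [dom T] into [ker G0] and [ker (T - l)]: subtracting from [f] the
    solution [f0] in [ker G0] of [(l - T) f0 = (l - T) f] leaves [G0 f] unchanged. *)
Lemma gamma_dom_ran y : ran (bmap T G0) y -> dom gamma y.
Proof.
move=> [f [/= Tf <-]]; have [f0 [Tf0 f00 eqf0]] := surj0 (l *: f - ap T f).
exists (f - f0); split; last first.
  by have /= -> := linop_apB linB0 Tf Tf0; rewrite f00 subr0.
split; first exact: linop_domB.
apply/esym/eqP; rewrite -subr_eq0; apply/eqP.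
have /= -> := linop_apB (linop_lminus l linT) Tf Tf0.
by rewrite eqf0 subrr.
Qed.

Lemma gamma_linop : linop gamma.
Proof.
have combo a x y : dom gamma x -> dom gamma y -> dom gamma (a *: x + y) /\
    ap gamma (a *: x + y) = a *: ap gamma x + ap gamma y.
  move=> /gamma_dom[f [Tf eqf <- ->]] /gamma_dom[g [Tg eqg <- ->]].
  have /= <- := linop_apL linB0 a Tf Tg; apply: gamma_ap; first exact: linop_domL.
  by rewrite linop_apL // eqf eqg scalerDr !scalerA mulrC.
split; [split|].
- rewrite -(linop_ap0 linB0); apply: gamma_dom_ran; exists 0; split=> //.
  exact: linop_dom0.
- by move=> a x y gx gy; have [] := combo a x y gx gy.
- by move=> a x y gx gy; have [] := combo a x y gx gy.
Qed.

Lemma weyl_ap f : dom T f -> ap T f = l *: f ->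
  dom (weyl_of T G0 G1 l) (G0 f) /\ ap (weyl_of T G0 G1 l) (G0 f) = G1 f.
Proof.
move=> Tf eqf; have [gdom gf] := gamma_ap Tf eqf; split; last exact: congr1 gf.
by split=> //; rewrite gf.
Qed.

Lemma weyl_dom y : dom (weyl_of T G0 G1 l) y -> exists f,
  [/\ dom T f, ap T f = l *: f, G0 f = y & ap (weyl_of T G0 G1 l) y = G1 f].
Proof.
by move=> [/gamma_dom[f [Tf eqf y0 gf]] _]; exists f; split=> //; exact: congr1 gf.
Qed.

End GammaField.

(** * Consequences of Green's identity for the gamma-fields *)

Section BoundaryTriple.
Variables (R : realType) (H G : lmodType R[i]).
Variables (ipH : H -> H -> R[i]) (ipG : G -> G -> R[i]).
Hypotheses (hilbH : is_hilbert ipH) (hilbG : is_hilbert ipG).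
Variables (T Tt : op H H) (G0 G1 Gt0 Gt1 : H -> G).
Hypotheses (linT : linop T) (linTt : linop Tt).
Hypotheses (linG0 : linear_on (dom T) G0) (linG1 : linear_on (dom T) G1).
Hypotheses (linGt0 : linear_on (dom Tt) Gt0).
Hypothesis green : forall f g, dom T f -> dom Tt g ->
  ipH (ap T f) g - ipH f (ap Tt g) = ipG (G1 f) (Gt0 g) - ipG (G0 f) (Gt1 g).
Hypothesis denseGt0 : dense ipG (ran (bmap Tt Gt0)).
Hypothesis denseA0 : dense ipH (dom (A0_of T G0)).
Hypothesis M1 : op_eq (adjoint ipH ipH (A0_of T G0)) (A0_of Tt Gt0).
Variable l : R[i].
Hypothesis rhoA0 : in_rho ipH (A0_of T G0) l.

Let ipHP : is_inner_product ipH := hilbH.1.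
Let ipGP : is_inner_product ipG := hilbG.1.
Let linA0 := A0_linop linT linG0.
Let linB1 : linop (bmap T G1) := conj linT.1 linG1.

Lemma A0_inj0 f : dom T f -> G0 f = 0 -> ap T f = l *: f -> f = 0.
Proof. by move=> Tf f0; apply: (in_rho_inj0 linA0 rhoA0). Qed.

Lemma A0_surj0 h : exists f, [/\ dom T f, G0 f = 0 & l *: f - ap T f = h].
Proof. by have [f [[Tf f0] eqf]] := rhoA0.2.1 h; exists f. Qed.

(** By Green's identity [g] is orthogonal to the range of [l - A_0], which is the whole space and so
    contains [g]. *)
Lemma At0_inj0 g : dom Tt g -> Gt0 g = 0 -> ap Tt g = l^* *: g -> g = 0.
Proof.
move=> Ttg g0 eqg; case: (ipHP) => _ _ _; apply.
have [f [Tf f0 {1}<-]] := A0_surj0 g.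
have := green Tf Ttg; rewrite g0 f0 ip0r // ip0l // subrr eqg ipZr // conjCK.
by move/eqP; rewrite subr_eq0 => /eqP fg; rewrite ipBl // ipZl // fg subrr.
Qed.

(* The preimage of [g] is the Riesz representative of [h |-> ((l - A0)^-1 h, g)]. *)
Lemma At0_surj0 g : exists f, [/\ dom Tt f, Gt0 f = 0 & l^* *: f - ap Tt f = g].
Proof.
have [Q [[linQ [K [K_ge0 QK]]] QP]] := in_rho_resolvent ipHP linA0 rhoA0.
have [||z zP] := @riesz _ _ _ hilbH (fun h => ipH (Q h) g) (K * ipnorm ipH g).
- by move=> a x y; rewrite linQ ipDl // ipZl.
- move=> x; apply: le_trans (cauchy_schwarz ipHP _ _) _.
  by rewrite lecR mulrAC ler_wpM2r ?ipnorm_ge0.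
have zA : adj_rel ipH ipH (A0_of T G0) z (l^* *: z - g).
  move=> f A0f; have [A0Q eqQ] := QP (l *: f - ap T f).
  have Qf : Q (l *: f - ap T f) = f by exact: rhoA0.1.
  have := zP (l *: f - ap T f); rewrite Qf ipBl // ipBr // ipZl // ipZr // conjCK.
  by move=> ->; rewrite subKr.
have [dz apz] := adjoint_ap ipHP denseA0 zA.
have [Ttz z0] := (M1.1 z).1 dz; have := M1.2 z dz; rewrite apz /= => eqz.
by exists z; split=> //; rewrite -eqz subKr.
Qed.

Let gammat := gamma_of Tt Gt0 (l^*).

Lemma gammat_dense : dense ipG (dom gammat).
Proof.
move=> x; have [u [uran ux]] := denseGt0 x; exists u; split=> // n.
exact: (gamma_dom_ran linTt linGt0 At0_surj0).
Qed.

(** Green's identity with [G0 f = 0] and second argument in the kernel of [Tt] minus the conjugate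
    of [l]. Both the formula for the adjoint of [gammat] and the boundedness of [G1 \o Q] rest on
    it. *)
Lemma gammat_green f x : dom T f -> G0 f = 0 -> dom gammat x ->
  ipH (l *: f - ap T f) (ap gammat x) = - ipG (G1 f) x.
Proof.
move=> Tf f0 /(gamma_dom linTt linGt0 At0_inj0)[g [Ttg eqg <- ->]].
have := green Tf Ttg; rewrite f0 ip0l // subr0 eqg ipZr // conjCK => <-.
by rewrite ipBl // ipZl // opprB.
Qed.

(** For [f = (A_0 - l)^-1 h] this evaluates the adjoint of [gammat] at [h] as [G1 (A_0 - l)^-1 h].
    The order [A_0 - l] absorbs the sign in [gammat_green]. *)
Lemma gammat_adjoint f : dom T f -> G0 f = 0 ->
  dom (adjoint ipG ipH gammat) (ap T f - l *: f) /\
  ap (adjoint ipG ipH gammat) (ap T f - l *: f) = G1 f.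
Proof.
move=> Tf f0; apply: adjoint_ap => //; first exact: gammat_dense.
move=> x gx; rewrite (ip_conj ipHP (ap T f - _)) -opprB ipNl // gammat_green //.
by rewrite opprK -ip_conj.
Qed.

(** If [u n -> 0] and [G1 (Q (u n)) -> z], then [(G1 (Q (u n)), x) = - (u n, gammat x)] tends to [0]
    for every [x] in the dense domain of [gammat], so [z = 0] and the closed graph theorem
    applies. *)
Lemma boundary_resolvent_bounded (Q : H -> H) : bounded_linear ipH ipH Q ->
  (forall h, dom (A0_of T G0) (Q h) /\ l *: Q h - ap T (Q h) = h) ->
  bounded_linear ipH ipG (G1 \o Q).
Proof.
move=> bQ QP.
have linGQ a x y : (G1 \o Q) (a *: x + y) = a *: (G1 \o Q) x + (G1 \o Q) y.
  rewrite /= bQ.1; apply: (linop_apL linB1).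
    by have [[]] := QP x.
  by have [[]] := QP y.
split=> //; apply: closed_graph => // u z u0 GQu.
apply: (dense_orth ipGP gammat_dense) => x gx.
rewrite (ip_conj ipGP z).
suff -> : ipG z x = ipH 0 (- ap gammat x) by rewrite ip0l // rmorph0.
apply: (cvg_ip_eq ipGP ipHP GQu u0) => n /=.
have [[TQ Q0] eqQ] := QP (u n); rewrite -[in RHS]eqQ.
by rewrite ipNr // gammat_green // opprK.
Qed.

(** Write the limit [y] as the conjugate of [l] times [g] minus [Tt g], with [Gt0 g = 0]. Green's
    identity gives [(gamma (u n), y) = - (u n, Gt1 g)], which tends to [0], so [(y, y) = 0]. *)
Lemma gamma_closable : closable ipG ipH (gamma_of T G0 l).
Proof.
move=> y [u [gu [u0 guy]]]; case: (ipHP) => _ _ _; apply.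
have [g [Ttg g0 eqg]] := At0_surj0 y.
rewrite -{2}eqg; rewrite -(ip0l ipGP (- Gt1 g)).
apply: (cvg_ip_eq ipHP ipGP guy u0) => n.
have [f [Tf eqf <- ->]] := gamma_dom linT linG0 A0_inj0 (gu n).
have := green Tf Ttg; rewrite g0 ip0r // sub0r eqf ipZl // => eq1.
by rewrite ipBr // ipZr // conjCK eq1 ipNr.
Qed.

End BoundaryTriple.

Lemma A_B1B2_linop (R : realType) (H G : lmodType R[i]) (T : op H H) (G0 G1 : H -> G)
    (B1 B2 : op G G) :
  linop T -> linear_on (dom T) G0 -> linear_on (dom T) G1 -> linop B1 -> linop B2 ->
  linop (A_B1B2 T G0 G1 B1 B2).
Proof.
move=> linT linG0 linG1 linB1 linB2; have linB := linop_comp linB1 linB2.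
have lin0 : linop (bmap T G0) := conj linT.1 linG0.
have lin1 : linop (bmap T G1) := conj linT.1 linG1.
split; last by move=> a x y [Tx _] [Ty _]; exact: (linop_apL linT).
split.
  have /= G00 := linop_ap0 lin0; have /= G10 := linop_ap0 lin1.
  split; first exact: linop_dom0.
  by rewrite G10 G00; split; [exact: (linop_dom0 linB)|exact: (linop_ap0 linB)].
move=> a x y [Tx [Bx eqx]] [Ty [By eqy]]; split; first exact: linop_domL.
have /= -> := linop_apL lin0 a Tx Ty; have /= -> := linop_apL lin1 a Tx Ty.
split; first exact: (linop_domL linB).
by have /= -> := linop_apL linB a Bx By; rewrite eqx eqy.
Qed.

(** * Resolvent points of [A_B1B2] and the resolvent formula *)

Section Krein.
Variables (R : realType) (H G : lmodType R[i]).
Variables (ipH : H -> H -> R[i]) (ipG : G -> G -> R[i]).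
Hypotheses (hilbH : is_hilbert ipH) (hilbG : is_hilbert ipG).
Variables (T Tt : op H H) (G0 G1 Gt0 Gt1 : H -> G).
Hypotheses (linT : linop T) (linTt : linop Tt).
Hypotheses (linG0 : linear_on (dom T) G0) (linG1 : linear_on (dom T) G1).
Hypotheses (linGt0 : linear_on (dom Tt) Gt0).
Hypothesis green : forall f g, dom T f -> dom Tt g ->
  ipH (ap T f) g - ipH f (ap Tt g) = ipG (G1 f) (Gt0 g) - ipG (G0 f) (Gt1 g).
Hypothesis denseGt0 : dense ipG (ran (bmap Tt Gt0)).
Hypothesis denseA0 : dense ipH (dom (A0_of T G0)).
Hypothesis M1 : op_eq (adjoint ipH ipH (A0_of T G0)) (A0_of Tt Gt0).
Variables B1 B2 : op G G.
Hypotheses (linB1 : linop B1) (linB2 : linop B2).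
Hypothesis hv : forall f, dom T f -> G0 f = 0 -> dom (op_comp B1 B2) (G1 f).

Let ipHP : is_inner_product ipH := hilbH.1.
Let ipGP : is_inner_product ipG := hilbG.1.
Let lin0 : linop (bmap T G0) := conj linT.1 linG0.
Let lin1 : linop (bmap T G1) := conj linT.1 linG1.
Let linA0 := A0_linop linT linG0.
Let linA := A_B1B2_linop linT linG0 linG1 linB1 linB2.

Section AtResolventPoint.
Variable l : R[i].
Hypothesis rhoA0 : in_rho ipH (A0_of T G0) l.
Let inj0 := A0_inj0 linT linG0 rhoA0.
Let surj0 := A0_surj0 rhoA0.
Local Notation gamma := (gamma_of T G0 l).
Local Notation M := (weyl_of T G0 G1 l).

Lemma weyl_linop : linop M.
Proof. by apply: linop_comp => //; exact: (gamma_linop linT linG0 inj0 surj0). Qed.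

Let linMB1 := linop_comp weyl_linop linB1.

(** With [Q = (l - A_0)^-1] and [P = (1 - B2 N)^-1], the bounded inverse of [l - A_B1B2] is
    [Q + gamma B1 P B2 G1 Q]. *)
Lemma A_B1B2_in_rho :
  closable ipG ipG B1 -> closable ipG ipG B2 -> closable ipG ipG (op_comp M B1) ->
  in_rho ipG (op_comp B2 (closure_op ipG ipG (op_comp M B1))) 1 ->
  (forall y, ran (op_comp B2 (closure_op ipG ipG (op_comp M B1))) y ->
     ran (bmap T G0) y /\ dom B1 y) ->
  (forall y, ran (bmap T G0) y -> dom B1 y -> ran (bmap T G0) (ap B1 y)) ->
  (forall y, ran (bmap T G1) y -> dom B2 y -> ran (bmap T G0) (ap B2 y)) ->
  in_rho ipH (A_B1B2 T G0 G1 B1 B2) l.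
Proof.
move=> clB1 clB2 clMB1 hi hii hiii hiv.
pose N := closure_op ipG ipG (op_comp M B1); rewrite -/N in hi hii.
have N_ext := closure_op_ext ipGP ipGP linMB1 clMB1.
have linN : linop (op_comp B2 N) by apply: linop_comp => //; exact: linop_closure.
have [Q [bQ QP]] := in_rho_resolvent ipHP linA0 rhoA0.
have [P [bP PP]] := in_rho_resolvent ipGP linN hi.
have bGQ : bounded_linear ipH ipG (G1 \o Q).
  exact: (boundary_resolvent_bounded hilbH hilbG linT linTt linG0 linG1 linGt0
    green denseGt0 denseA0 M1 rhoA0 bQ QP).
have domB h : dom B2 (G1 (Q h)) /\ dom B1 (ap B2 (G1 (Q h))).
  by have [[TQ Q0] _] := QP h; exact: hv.
have bB2 : bounded_linear ipH ipG (ap B2 \o (G1 \o Q)).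
  by apply: (closable_comp_bounded hilbH ipGP) => // h; have [] := domB h.
pose phi h := P (ap B2 (G1 (Q h))).
have bphi : bounded_linear ipH ipG phi := bounded_linear_comp bP bB2.
have phiP h : [/\ dom N (phi h), dom B2 (ap N (phi h)) &
    phi h = ap B2 (G1 (Q h)) + ap B2 (ap N (phi h))].
  have [[dN dB2] eqphi] := PP (ap B2 (G1 (Q h))); split=> //.
  by apply/eqP; rewrite -subr_eq -[X in X - _]scale1r; apply/eqP.
(* In [phi = B2 G1 Q h + B2 N phi], the first summand is covered by [hiv] and [hv], the second by
   [hii]. Lying in [ran G0] lets [hiii] place [B1 phi] in the domain of [gamma]. *)
have phi_dom h : ran (bmap T G0) (phi h) /\ dom B1 (phi h).
  have [[TQ _] _] := QP h; have [dN dB2 phiE] := phiP h; have [dQ2 dQ1] := domB h.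
  have [|[f [/= Tf f0]] dC] := hii (ap B2 (ap N (phi h))); first by exists (phi h).
  have [|g [/= Tg g0]] := hiv (G1 (Q h)) _ dQ2; first by exists (Q h).
  rewrite phiE; split; last exact: linop_domD.
  exists (g + f); split; first exact: linop_domD.
  by have /= -> := linop_apD lin0 Tg Tf; rewrite g0 f0.
have bB1 : bounded_linear ipH ipG (ap B1 \o phi).
  by apply: (closable_comp_bounded hilbH ipGP) => // h; have [] := phi_dom h.
have gam_dom h : dom gamma (ap B1 (phi h)).
  apply: (gamma_dom_ran linT linG0 surj0).
  by have [] := phi_dom h; exact: hiii.
have bgam : bounded_linear ipH ipH (ap gamma \o (ap B1 \o phi)).
  apply: (closable_comp_bounded hilbH ipGP) => //.
    exact: (gamma_linop linT linG0 inj0 surj0).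
  exact: (gamma_closable hilbH hilbG linT linG0 green denseA0 M1 rhoA0).
have bK := bounded_linearD ipHP bQ bgam.
apply: (in_rho_of_bounded ipHP linA bK) => [f [Tf [[dB2 dB1] eqB]] eqf|h].
  (* For an eigenvector [f] at [l], [phi = B2 G1 f] satisfies [N phi = M B1 phi = M G0 f = G1 f], so
     [(1 - B2 N) phi = 0] and [phi = 0]. Then [G0 f = B1 phi = 0], and [f] is an eigenvector of
     [A_0]. *)
  have [dM eqM] := weyl_ap G1 linT linG0 inj0 Tf eqf.
  have dMB : dom (op_comp M B1) (ap B2 (G1 f)) by split=> //; rewrite eqB.
  have [dN eqN] := N_ext _ dMB.
  have eqN' : ap N (ap B2 (G1 f)) = G1 f.
    by rewrite eqN -[LHS]/(ap M (ap B1 (ap B2 (G1 f)))) eqB.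
  have B2f0 : ap B2 (G1 f) = 0.
    apply: (in_rho_inj0 linN hi); first by split=> //; rewrite eqN'.
    by rewrite scale1r -[LHS]/(ap B2 (ap N (ap B2 (G1 f)))) eqN'.
  by apply: inj0 => //; rewrite -eqB B2f0 linop_ap0.
have [[TQ Q0] eqQ] := QP h; have [dN dB2 phiE] := phiP h.
have [_ dB1] := phi_dom h; have [dQ2 dQ1] := domB h.
have [f [Tf eqf f0 gf]] := gamma_dom linT linG0 inj0 (gam_dom h).
have -> : (Q \+ (ap gamma \o (ap B1 \o phi))) h = Q h + f by rewrite -gf.
have TK := linop_domD linT TQ Tf.
have [dM eqM] := weyl_ap G1 linT linG0 inj0 Tf eqf; rewrite f0 in dM eqM.
(* [phi h] lies in the domain of [M B1] itself, so the closure [N] takes there the value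
   [M B1 phi = G1 f]. *)
have [_ eqN] := N_ext (phi h) (conj dB1 dM).
have {}eqN : ap N (phi h) = G1 f by rewrite eqN -eqM.
rewrite eqN in dB2 phiE.
split; last first.
  by rewrite /= (linop_apD linT TQ Tf) scalerDr eqf opprD addrACA subrr addr0.
split=> //.
have /= -> := linop_apD lin0 TQ Tf; have /= -> := linop_apD lin1 TQ Tf.
have B2E : ap B2 (G1 (Q h) + G1 f) = phi h by rewrite linop_apD // -phiE.
rewrite Q0 add0r f0; split; last by rewrite B2E.
by split; [exact: linop_domD|rewrite B2E].
Qed.

Hypothesis rhoA : in_rho ipH (A_B1B2 T G0 G1 B1 B2) l.

(** A kernel vector [d] gives [f = gamma B1 d] with [G0 f = B1 d] and [B2 G1 f = d], an eigenvector
    of [A_B1B2] at [l]; hence [f = 0] and [d = B2 G1 f = 0]. *)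
Lemma one_minus_B2MB1_inj phi psi :
  dom (op_comp B2 (op_comp M B1)) phi -> dom (op_comp B2 (op_comp M B1)) psi ->
  ap (lminus 1 (op_comp B2 (op_comp M B1))) phi =
  ap (lminus 1 (op_comp B2 (op_comp M B1))) psi -> phi = psi.
Proof.
move=> dphi dpsi eq_pp; have linD := linop_lminus 1 (linop_comp linB2 linMB1).
apply/eqP; rewrite -subr_eq0; apply/eqP.
have dd := linop_domB linD dphi dpsi; have := linop_apB linD dphi dpsi.
rewrite eq_pp subrr; move: dd; set d := phi - psi => -[[dB1 dM] dB2].
rewrite -[X in X = _]/(1 *: d - ap B2 (ap M (ap B1 d))) scale1r.
move=> /eqP; rewrite subr_eq0 => /eqP dE.
have [f [Tf eqf f0 Mf]] := weyl_dom linT linG0 inj0 dM.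
have Mf' : ap (op_comp M B1) d = G1 f := Mf.
rewrite Mf' in dB2; rewrite Mf in dE.
have f_0 : f = 0.
  apply: (in_rho_inj0 linA rhoA) => //; split=> //; rewrite -dE f0.
  by split=> //; split=> //; rewrite -dE.
have /= G10 := linop_ap0 lin1.
by rewrite dE f_0 G10 linop_ap0.
Qed.

(** Let [f] and [f0] be the two resolvents at [h]. Then [f - f0] lies in [ker (T - l)] with
    [G0 (f - f0) = B1 phi] for [phi = B2 G1 f], so [M B1 phi = G1 f - G1 f0]. Applying [B2] gives
    [(1 - B2 M B1) phi = B2 G1 f0], and [f - f0 = gamma B1 phi]. *)
Lemma krein_formula :
  op_eq (op_inv (minusl (A_B1B2 T G0 G1 B1 B2) l))
    (op_add (op_inv (minusl (A0_of T G0) l))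
      (op_comp gamma
        (op_comp B1
          (op_comp (op_inv (lminus 1 (op_comp B2 (op_comp M B1))))
            (op_comp B2 (adjoint ipG ipH (gamma_of Tt Gt0 (l^*)))))))).
Proof.
(* [in_rho] is phrased with [l - A], the formula with [A - l]; negation passes between them. *)
have minusl_inj (A : op H H) : in_rho ipH A l -> forall x y,
    dom (minusl A l) x -> dom (minusl A l) y ->
    ap (minusl A l) x = ap (minusl A l) y -> x = y.
  move=> rho x y Ax Ay /= eqxy; apply: rho.1 => //.
  by rewrite -opprB eqxy opprB.
have resolvent (A : op H H) h : in_rho ipH A l ->
    exists f, dom A f /\ ap A f - l *: f = h.
  move=> rho; have [f [Af eqf]] := rho.2.1 (- h); exists f; split=> //.
  by rewrite -opprB eqf opprK.
have both h : dom (op_inv (minusl (A_B1B2 T G0 G1 B1 B2) l)) h /\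
    dom (op_inv (minusl (A0_of T G0) l)) h.
  by split; [exact: (resolvent _ h rhoA)|exact: (resolvent _ h rhoA0)].
set X := op_comp gamma _.
(* Both resolvents are defined everywhere, so the equality of operators, domains included, reduces
   to each [h] lying in the domain of [X] with the right value. *)
suff formula h : exists k,
    [/\ dom X h, ap X h = k & ap (op_inv (minusl (A_B1B2 T G0 G1 B1 B2) l)) h =
        ap (op_inv (minusl (A0_of T G0) l)) h + k].
  split=> h; have [k [dX Xk eqk]] := formula h; have [d1 d2] := both h.
    by split.
  by move=> _; rewrite eqk -Xk.
have [f [Af eqf]] := resolvent _ h rhoA; have [f0 [A0f0 eqf0]] := resolvent _ h rhoA0.
have Ah : ap (op_inv (minusl (A_B1B2 T G0 G1 B1 B2) l)) h = f.
  by rewrite -eqf; apply: (op_inv_ap (minusl_inj _ rhoA)).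
have A0h : ap (op_inv (minusl (A0_of T G0) l)) h = f0.
  by rewrite -eqf0; apply: (op_inv_ap (minusl_inj _ rhoA0)).
exists (f - f0); rewrite /X Ah A0h subrKC.
have [Tf [[dB2 dB1] eqB]] := Af; have [Tf0 G0f0] := A0f0.
have [dadj] := gammat_adjoint hilbH hilbG linT linTt linG0 linGt0 green denseGt0
  denseA0 M1 rhoA0 Tf0 G0f0.
rewrite eqf0 in dadj *; set adj := adjoint _ _ _ in dadj * => adjE.
have [dQ2 dQ1] := hv Tf0 G0f0.
have Td := linop_domB linT Tf Tf0.
have eqd : ap T (f - f0) = l *: (f - f0).
  move: eqf eqf0 => /= eqf eqf0; rewrite linop_apB // scalerBr.
  rewrite -[ap T f](subrK (l *: f)) eqf -[ap T f0](subrK (l *: f0)) eqf0.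
  by rewrite opprD addrACA subrr add0r.
have /= G0d := linop_apB lin0 Tf Tf0; rewrite G0f0 subr0 -eqB in G0d.
have /= G1d := linop_apB lin1 Tf Tf0.
have [dgam eqgam] := gamma_ap linT linG0 inj0 Td eqd.
have [dM eqM] := weyl_ap G1 linT linG0 inj0 Td eqd.
rewrite G0d in dgam eqgam dM eqM; rewrite G1d in eqM.
set phi := ap B2 (G1 f) in dB1 eqB dgam eqgam dM eqM.
have dD : dom (op_comp B2 (op_comp M B1)) phi.
  by split=> //; rewrite -[ap (op_comp _ _) _]/(ap M (ap B1 phi)) eqM; exact: linop_domB.
set D := lminus 1 _.
have eqD : ap D phi = ap B2 (G1 f0).
  rewrite -[LHS]/(1 *: phi - ap B2 (ap M (ap B1 phi))) eqM linop_apB // scale1r.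
  by rewrite opprB addrC subrK.
have invD : ap (op_inv D) (ap B2 (G1 f0)) = phi.
  by rewrite -eqD; exact: (@op_inv_ap _ _ _ D _ one_minus_B2MB1_inj dD).
have inner : ap (op_comp (op_inv D) (op_comp B2 adj)) h = phi.
  by rewrite -[LHS]/(ap (op_inv D) (ap B2 (ap adj h))) adjE.
have d1 : dom B2 (ap adj h) by rewrite adjE.
have d2 : dom (op_inv D) (ap B2 (ap adj h)) by rewrite adjE; exists phi.
have d3 : dom B1 (ap (op_comp (op_inv D) (op_comp B2 adj)) h) by rewrite inner.
have d4 : dom gamma (ap B1 (ap (op_comp (op_inv D) (op_comp B2 adj)) h)).
  by rewrite inner.
have dX : dom X h := conj (conj (conj (conj dadj d1) d2) d3) d4.
split=> //.
rewrite -[LHS]/(ap gamma (ap B1 (ap (op_comp (op_inv D) (op_comp B2 adj)) h))).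
by rewrite inner.
Qed.

End AtResolventPoint.
End Krein.

Theorem theorem4p7 (R : realType) (H G : lmodType R[i])
  (ipH : H -> H -> R[i]) (ipG : G -> G -> R[i])
  (hilbH : is_hilbert ipH) (sepH : separable ipH) (hilbG : is_hilbert ipG)
  (* adjoint pair {S, St} *)
  (S St : op H H)
  (linS : linop S) (linSt : linop St)
  (denseS : dense ipH (dom S)) (denseSt : dense ipH (dom St))
  (closedS : closed_op ipH ipH S) (closedSt : closed_op ipH ipH St)
  (adjpair : forall f g, dom S f -> dom St g -> ipH (ap S f) g = ipH f (ap St g))
  (* cores T of S^* and Tt of St^* *)
  (T Tt : op H H) (linT : linop T) (linTt : linop Tt)
  (TsubS : op_sub T (adjoint ipH ipH S))
  (TcoreS : op_eq (closure_op ipH ipH T) (adjoint ipH ipH S))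
  (TtsubSt : op_sub Tt (adjoint ipH ipH St))
  (TtcoreSt : op_eq (closure_op ipH ipH Tt) (adjoint ipH ipH St))
  (* the triple *)
  (G0 G1 Gt0 Gt1 : H -> G)
  (linG0 : linear_on (dom T) G0) (linG1 : linear_on (dom T) G1)
  (linGt0 : linear_on (dom Tt) Gt0) (linGt1 : linear_on (dom Tt) Gt1)
  (* (G) *)
  (green : forall f g, dom T f -> dom Tt g ->
     ipH (ap T f) g - ipH f (ap Tt g) = ipG (G1 f) (Gt0 g) - ipG (G0 f) (Gt1 g))
  (* (D) *)
  (denseG0 : dense ipG (ran (bmap T G0))) (denseGt0 : dense ipG (ran (bmap Tt Gt0)))
  (* (M), including that A_0 and At_0 are densely defined *)
  (denseA0 : dense ipH (dom (A0_of T G0))) (denseAt0 : dense ipH (dom (A0_of Tt Gt0)))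
  (M1 : op_eq (adjoint ipH ipH (A0_of T G0)) (A0_of Tt Gt0))
  (M2 : op_eq (adjoint ipH ipH (A0_of Tt Gt0)) (A0_of T G0))
  (* rho(A_0) nonempty *)
  (rho_ne : exists l, in_rho ipH (A0_of T G0) l)
  (* B1, B2 *)
  (B1 B2 : op G G) (linB1 : linop B1) (linB2 : linop B2)
  (clB1 : closable ipG ipG B1) (clB2 : closable ipG ipG B2)
  (l0 : R[i]) (l0rho : in_rho ipH (A0_of T G0) l0)
  (clMB1 : closable ipG ipG (op_comp (weyl_of T G0 G1 l0) B1))
  (hi : in_rho ipG (op_comp B2 (closure_op ipG ipG (op_comp (weyl_of T G0 G1 l0) B1))) 1)
  (hii : forall y, ran (op_comp B2 (closure_op ipG ipG (op_comp (weyl_of T G0 G1 l0) B1))) y ->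
     ran (bmap T G0) y /\ dom B1 y)
  (hiii : forall y, ran (bmap T G0) y -> dom B1 y -> ran (bmap T G0) (ap B1 y))
  (hiv : forall y, ran (bmap T G1) y -> dom B2 y -> ran (bmap T G0) (ap B2 y))
  (hv : forall f, dom T f -> G0 f = 0 -> dom (op_comp B1 B2) (G1 f)) :
  closed_op ipH ipH (A_B1B2 T G0 G1 B1 B2) /\
  in_rho ipH (A_B1B2 T G0 G1 B1 B2) l0 /\
  forall l : R[i], in_rho ipH (A0_of T G0) l -> in_rho ipH (A_B1B2 T G0 G1 B1 B2) l ->
    op_eq (op_inv (minusl (A_B1B2 T G0 G1 B1 B2) l))
      (op_add (op_inv (minusl (A0_of T G0) l))
        (op_comp (gamma_of T G0 l)
          (op_comp B1
            (op_comp (op_inv (lminus 1 (op_comp B2 (op_comp (weyl_of T G0 G1 l) B1))))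
              (op_comp B2 (adjoint ipG ipH (gamma_of Tt Gt0 (l^*)))))))).
Proof.
have rhoA : in_rho ipH (A_B1B2 T G0 G1 B1 B2) l0.
  exact: (A_B1B2_in_rho hilbH hilbG linT linTt linG0 linG1 linGt0 green denseGt0
    denseA0 M1 linB1 linB2 hv l0rho).
split.
  (* Closedness follows from the existence of a single resolvent point, [l0]. *)
  by apply: in_rho_closed rhoA; [case: hilbH|exact: A_B1B2_linop].
split=> // l rhoA0l rhoAl.
exact: (krein_formula hilbH hilbG linT linTt linG0 linG1 linGt0 green denseGt0
  denseA0 M1 linB1 linB2 hv rhoA0l rhoAl).
Qed.
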